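(* Let $G$ be a finite diagonal graph. Then the magnitude cohomology ring $\mathrm{MH}^*_*(G)$ is isomorphic to the quotient of the path algebra of $G$ by the relations \[ \sum_{y\colon d(x,y)=d(y,z)=1}xyz=0 \] for each pair of vertices $x,z$ with $d(x,z)=2$, where the degree $k$ part of this quotient (with respect to path length) corresponds to $\mathrm{MH}^k_k(G)$.
   Context: Graphs are undirected, without loops or multiple edges, and are regarded as extended metric spaces by equipping the vertex set with the shortest-path metric $d$ ($d(x,y)=\infty$ if there is no path from $x$ to $y$). Path algebra: an edge path in $G$ is a sequence $x_0\cdots x_k$ ($k\geq0$) of vertices such that each consecutive pair $x_{i-1},x_i$ spans an edge. The path algebra of $G$ is the $\mathbb{Z}$-algebra with basis the edge paths and multiplication $(x_0\cdots x_k)\cdot(y_0\cdots y_l)=x_0\cdots x_ky_1\cdots y_l$ if $x_k=y_0$ and $0$ otherwise, graded by path length $k$. The quotient by the relations is the quotient by the two-sided ideal they generate. Magnitude (co)homology of an extended metric space $X$ with metric $d$: a $k$-simplex ($k\ge 0$) in $X$ is a tuple $(x_0,\ldots,x_k)\in X^{k+1}$ with $x_{i-1}\neq x_i$ for all $i$; its length is $\ell(x_0,\ldots,x_k)=d(x_0,x_1)+\cdots+d(x_{k-1},x_k)$. For $\ell\in[0,\infty)$, $\mathrm{MC}_{k,\ell}(X)$ is the free abelian group on the $k$-simplices of length $\ell$, with differential $\partial=\sum_{i=1}^{k-1}(-1)^i\partial_i\colon \mathrm{MC}_{k,\ell}(X)\to\mathrm{MC}_{k-1,\ell}(X)$, where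 $\partial_i(x_0,\ldots,x_k)=(x_0,\ldots,\widehat{x_i},\ldots,x_k)$ if $d(x_{i-1},x_{i+1})=d(x_{i-1},x_i)+d(x_i,x_{i+1})$ and $0$ otherwise. The magnitude homology is $\mathrm{MH}_{k,\ell}(X)=H_k(\mathrm{MC}_{*,\ell}(X))$. The magnitude cochain complex is $\mathrm{MC}^k_\ell(X)=\mathrm{Hom}(\mathrm{MC}_{k,\ell}(X),\mathbb{Z})$ with differential $\partial^*\varphi=\varphi\circ\partial$, and $\mathrm{MH}^k_\ell(X)=H^k(\mathrm{MC}^*_\ell(X))$. For $\varphi\in\mathrm{MC}^{k_1}_{\ell_1}(X)$ and $\psi\in\mathrm{MC}^{k_2}_{\ell_2}(X)$, the product $\varphi\cdot\psi\in\mathrm{MC}^{k_1+k_2}_{\ell_1+\ell_2}(X)$ sends a simplex $(x_0,\ldots,x_{k_1+k_2})$ of length $\ell_1+\ell_2$ to $\varphi(x_0,\ldots,x_{k_1})\,\psi(x_{k_1},\ldots,x_{k_1+k_2})$ if $\ell(x_0,\ldots,x_{k_1})=\ell_1$ and $\ell(x_{k_1},\ldots,x_{k_1+k_2})=\ell_2$, and to $0$ otherwise. The unit is the cochain $u\in\mathrm{MC}^0_0(X)$ with $u(x_0)=1$ for every $0$-simplex. This makes $\mathrm{MH}^*_*(X)$ into an associative unital bigraded ring. A graph $G$ is diagonal if $\mathrm{MH}_{k,\ell}(G)=0$ whenever $k\neq\ell$. *)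

(* Defs.v *)
From HB Require Import structures.
From mathcomp Require Import all_boot all_order all_algebra.
From mathcomp Require Import boolp functions.
From mathcomp Require Import freeg.

Set Implicit Arguments.
Unset Strict Implicit.
Unset Printing Implicit Defensive.

Import GRing.Theory.
Local Open Scope ring_scope.
Local Open Scope quotient_scope.

(* [pzRingType] is used throughout: for the graph without vertices both rings
   of the theorem are the zero ring. *)

Definition two_sided_ideal (R : pzRingType) (I : {pred R}) : Prop :=
  [/\ 0 \in I,
      forall x y, x \in I -> y \in I -> x - y \in I,
      forall a x, x \in I -> a * x \in I
    & forall a x, x \in I -> x * a \in I].

Record ideal2 (R : pzRingType) := Ideal2 {
  ideal2_pred :> {pred R};
  ideal2P : two_sided_ideal ideal2_pred
}.

Section RingQuotient.
Variables (R : pzRingType) (I : ideal2 R).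

Fact ideal2_zmod_closed : zmod_closed (ideal2_pred I).
Proof. by case: (ideal2P I). Qed.

HB.instance Definition _ :=
  GRing.isZmodClosed.Build R (ideal2_pred I) ideal2_zmod_closed.

Definition ring_quot : Type := Quotient.quot (ideal2_pred I).
HB.instance Definition _ := GRing.Zmodule.on ring_quot.
HB.instance Definition _ :
  EqQuotient R (Quotient.equiv (ideal2_pred I)) ring_quot :=
  EqQuotient.on ring_quot.

Definition rq_one : ring_quot := \pi_ring_quot 1.
Definition rq_mul := lift_op2 ring_quot *%R.

Lemma ring_quotE (x y : R) :
  (\pi_ring_quot x == \pi_ring_quot y) = (x - y \in ideal2_pred I).
Proof. by rewrite piE /= Quotient.equivE. Qed.

Lemma pi_rq_mul (x y : R) :
  rq_mul (\pi_ring_quot x) (\pi_ring_quot y) = \pi_ring_quot (x * y).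
Proof.
unlock rq_mul; apply/eqP; rewrite ring_quotE.
set x' := repr (_ x); set y' := repr (_ y).
have hx : x' - x \in ideal2_pred I by rewrite -ring_quotE reprK.
have hy : y' - y \in ideal2_pred I by rewrite -ring_quotE reprK.
have -> : x' * y' - x * y = (x' - x) * y' + x * (y' - y).
  by rewrite mulrBl mulrBr addrA addrNK.
case: (ideal2P I) => _ _ hl hr.
by apply: rpredD; [apply: hr | apply: hl].
Qed.

Lemma pi_rq_add (x y : R) :
  \pi_ring_quot x + \pi_ring_quot y = \pi_ring_quot (x + y).
Proof. exact: (esym (@Quotient.pi_add R (ideal2_pred I) x y)). Qed.

Fact rq_mulA : associative rq_mul.
Proof.
elim/quotW=> a; elim/quotW=> b; elim/quotW=> c.
by rewrite !pi_rq_mul mulrA.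
Qed.
Fact rq_mul1 : left_id rq_one rq_mul.
Proof. by elim/quotW=> a; rewrite pi_rq_mul mul1r. Qed.
Fact rq_mulr1 : right_id rq_one rq_mul.
Proof. by elim/quotW=> a; rewrite pi_rq_mul mulr1. Qed.
Fact rq_mulDl : left_distributive rq_mul +%R.
Proof.
elim/quotW=> a; elim/quotW=> b; elim/quotW=> c.
by rewrite pi_rq_add !pi_rq_mul pi_rq_add mulrDl.
Qed.
Fact rq_mulDr : right_distributive rq_mul +%R.
Proof.
elim/quotW=> a; elim/quotW=> b; elim/quotW=> c.
by rewrite pi_rq_add !pi_rq_mul pi_rq_add mulrDr.
Qed.

HB.instance Definition _ := GRing.Zmodule_isPzRing.Build ring_quot
  rq_mulA rq_mul1 rq_mulr1 rq_mulDl rq_mulDr.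

End RingQuotient.

Section GeneratedIdeal.
Variables (R : pzRingType) (S : R -> Prop).

Definition gen_ideal_pred : {pred R} := fun x =>
  `[< forall I : {pred R}, two_sided_ideal I ->
        (forall s, S s -> s \in I) -> x \in I >].

Fact gen_ideal_subproof : two_sided_ideal gen_ideal_pred.
Proof.
split.
- by apply/asboolP => I [].
- move=> x y /asboolP hx /asboolP hy; apply/asboolP => I hI hS.
  by case: (hI) => _ hB _ _; apply: hB; [apply: hx | apply: hy].
- move=> a x /asboolP hx; apply/asboolP => I hI hS.
  by case: (hI) => _ _ hl _; apply/hl/hx.
- move=> a x /asboolP hx; apply/asboolP => I hI hS.
  by case: (hI) => _ _ _ hr; apply/hr/hx.
Qed.

Definition gen_ideal : ideal2 R := Ideal2 gen_ideal_subproof.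

End GeneratedIdeal.

Lemma triangular_sum (V : zmodType) (n : nat) (F : nat -> nat -> V) :
  \sum_(0 <= j < n.+1) \sum_(0 <= i < j.+1) F i (j - i)%N =
  \sum_(0 <= i < n.+1) \sum_(0 <= j < (n - i).+1) F i j.
Proof.
elim: n => [|n IH]; first by rewrite !big_nat1 !subnn.
rewrite big_nat_recr //= IH [RHS]big_nat_recr //= subnn big_nat1.
rewrite [X in _ + X]big_nat_recr //= subnn addrA; congr (_ + _).
rewrite -big_split /=; apply: eq_big_nat => i /andP[_ hi].
by rewrite subSn // [RHS]big_nat_recr.
Qed.

Section FreeLift.
Variables (R : comNzRingType) (K : choiceType) (M : lmodType R) (f : K -> M).

Lemma fglift_is_linear : linear (fglift f).
Proof.
pose g := GRing.isAdditive.Build _ _ (fglift f) (lift_is_additive f).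
pose F : {additive {freeg K / R} -> M} := HB.pack (fglift f) g.
have FE D : fglift f D = F D by [].
move=> a D E; rewrite !FE raddfD; congr (_ + _).
rewrite -[D in LHS]freeg_sumE -[D in RHS]freeg_sumE scaler_sumr !raddf_sum.
apply: eq_bigr => x _.
have -> : a *: << coeff x D *g x >> = << a * coeff x D *g x >>.
  by apply/eqP/freeg_eqP => y; rewrite coeffZ !coeffU mulrA.
by rewrite -!FE !liftU /= scalerA.
Qed.
HB.instance Definition _ :=
  GRing.isLinear.Build R {freeg K / R} M *:%R (fglift f) fglift_is_linear.

End FreeLift.

(* [None] stands for the value infinity. *)
Definition oaddn (a b : option nat) : option nat :=
  if a is Some m then if b is Some n then Some (m + n)%N else None else None.

Section GraphMetric.
Variables (T : finType) (e : rel T).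

Definition has_path (x y : T) : pred nat := fun n =>
  [exists p : n.-tuple T, path e x p && (last x p == y)].

Definition gdist (x y : T) : option nat :=
  if pselect (exists n, has_path x y n) is left h then Some (ex_minn h)
  else None.

Lemma gdistxx x : gdist x x = Some 0%N.
Proof.
rewrite /gdist; case: pselect => [h|[]].
  case: ex_minnP => m _ /(_ 0%N) hm; congr Some; apply/eqP.
  rewrite -leqn0; apply: hm; apply/existsP; exists [tuple].
  by rewrite /= eqxx.
by exists 0%N; apply/existsP; exists [tuple]; rewrite /= eqxx.
Qed.

Lemma gdist_eq0 x y : gdist x y = Some 0%N -> x = y.
Proof.
rewrite /gdist; case: pselect => // h [].
by case: ex_minnP => m /existsP[p /andP[_ /eqP<-]] _ m0; move: p; rewrite m0 => p;
   rewrite tuple0.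
Qed.

End GraphMetric.

(* The distance takes values in the natural numbers and infinity, as for a
   graph. All finite lengths are then natural numbers, so the bidegrees (k, l)
   with l not a natural number only contribute zero groups and the second
   degree is taken in [nat]. *)
Section Magnitude.
Variables (T : choiceType) (d : T -> T -> option nat).

(* The nonempty sequence x0, x1, .., xk is represented by (x0, [:: x1; ...; xk]). *)
Fixpoint wlen (x : T) (s : seq T) : option nat :=
  if s is y :: s' then oaddn (d x y) (wlen y s') else Some 0%N.

(* A tuple of infinite length is a generator of none of the groups MC_{k,l},
   so only the simplices of finite length are kept. *)
Definition is_simplex (w : T * seq T) : bool :=
  path [rel x y | x != y] w.1 w.2 && (wlen w.1 w.2 != None).

Definition simplex : Type := {w : T * seq T | is_simplex w}.
HB.instance Definition _ := Choice.on simplex.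
HB.instance Definition _ := SubType.on simplex.

Definition dim (s : simplex) : nat := size (val s).2.
Definition len (s : simplex) : nat := odflt 0%N (wlen (val s).1 (val s).2).

Definition vertex (w : T * seq T) (i : nat) : T := nth w.1 (w.1 :: w.2) i.

(* Deletion of the i-th vertex, for 0 < i. *)
Definition wface (w : T * seq T) (i : nat) : T * seq T :=
  (w.1, take i.-1 w.2 ++ drop i w.2).

Definition smooth_at (w : T * seq T) (i : nat) : bool :=
  d (vertex w i.-1) (vertex w i.+1) ==
  oaddn (d (vertex w i.-1) (vertex w i)) (d (vertex w i) (vertex w i.+1)).

(* [insub] does not fail here when [d x y = Some 0] is equivalent to [x = y]: see
   [wface_simplex] below. *)
Definition face (s : simplex) (i : nat) : {freeg simplex / int} :=
  if smooth_at (val s) i then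
    if insub (wface (val s) i) is Some t then << t >> else 0
  else 0.

Definition bdry_simplex (s : simplex) : {freeg simplex / int} :=
  \sum_(1 <= i < dim s) ((-1) ^+ i : int) *: face s i.

(* The differentials of all the complexes MC_{*,l} together, on the direct sum of
   the groups MC_{k,l}. *)
Definition bdry : {freeg simplex / int} -> {freeg simplex / int} :=
  fglift bdry_simplex.

Definition MC (k l : nat) (c : {freeg simplex / int}) : Prop :=
  forall s, s \in dom c -> dim s = k /\ len s = l.

Definition MH_vanishes (k l : nat) : Prop :=
  forall c, MC k l c -> bdry c = 0 -> exists2 b, MC k.+1 l b & bdry b = c.

(* The direct sum over (k, l) of the groups Hom(MC_{k,l}, Z). A homomorphism
   on the free group MC_{k,l} is given by its values on simplices, so an
   element of the direct sum is a function on all simplices which vanishes on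
   the simplices of all but finitely many bidegrees. *)
Definition fin_bideg : {pred simplex -> int} := fun phi =>
  `[< exists B : seq (nat * nat),
        forall s, phi s != 0 -> (dim s, len s) \in B >].

Fact fin_bideg_zmod_closed : zmod_closed fin_bideg.
Proof.
split; first by apply/asboolP; exists [::] => s; rewrite eqxx.
move=> f g /asboolP[B hB] /asboolP[C hC]; apply/asboolP; exists (B ++ C) => s.
rewrite mem_cat; apply: contraR; rewrite negb_or => /andP[nB nC].
have -> : (f - g) s = f s - g s by [].
have /eqP-> : f s == 0 by apply: contraR nB => /hB.
have /eqP-> : g s == 0 by apply: contraR nC => /hC.
by rewrite subr0.
Qed.
HB.instance Definition _ :=
  GRing.isZmodClosed.Build (simplex -> int) fin_bideg fin_bideg_zmod_closed.

Record cochain := Cochain {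
  cfun :> simplex -> int;
  cfunP : cfun \in fin_bideg
}.
HB.instance Definition _ := [isSub for cfun].
HB.instance Definition _ := [Choice of cochain by <:].
HB.instance Definition _ := [SubChoice_isSubZmodule of cochain by <:].

Lemma cochainP (f g : cochain) : (forall s, f s = g s) <-> f = g.
Proof. by split=> [h|-> //]; apply/val_inj/funext. Qed.

Lemma cochainDE (f g : cochain) s : (f + g) s = f s + g s.
Proof. by []. Qed.

Lemma cochainBE (f g : cochain) s : (f - g) s = f s - g s.
Proof. by []. Qed.

Definition wfront (w : T * seq T) (j : nat) := (w.1, take j w.2).
Definition wback (w : T * seq T) (j : nat) :=
  (last w.1 (take j w.2), drop j w.2).

Lemma wlen_cat x s t : wlen x (s ++ t) = oaddn (wlen x s) (wlen (last x s) t).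
Proof.
elim: s x => [|y s IH] x /=; first by case: wlen.
by rewrite IH; case: (d x y) => //= m; case: (wlen y s) => //= n;
   case: (wlen _ t) => //= p; rewrite addnA.
Qed.

Lemma is_simplex_split w j :
  is_simplex w = is_simplex (wfront w j) && is_simplex (wback w j).
Proof.
case: w => x s; rewrite /is_simplex /= -{1 2}(cat_take_drop j s).
rewrite cat_path wlen_cat.
case: (path _ x _) => //=; case: (path _ _ (drop _ _)); rewrite ?andbF //=.
by case: (wlen x _) => //= m; case: (wlen _ _).
Qed.

Fact front_subproof (s : simplex) j : is_simplex (wfront (val s) j).
Proof. by have := valP s; rewrite (is_simplex_split _ j) => /andP[]. Qed.
Fact back_subproof (s : simplex) j : is_simplex (wback (val s) j).
Proof. by have := valP s; rewrite (is_simplex_split _ j) => /andP[]. Qed.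

Definition front (s : simplex) (j : nat) : simplex :=
  exist (fun w => is_simplex w) (wfront (val s) j) (front_subproof s j).
Definition back (s : simplex) (j : nat) : simplex :=
  exist (fun w => is_simplex w) (wback (val s) j) (back_subproof s j).

Lemma len_split s j : len s = (len (front s j) + len (back s j))%N.
Proof.
have := front_subproof s j; have := back_subproof s j.
rewrite /len /is_simplex /= => /andP[_] + /andP[_].
rewrite -[in X in _ -> _ -> X = _](cat_take_drop j (val s).2) wlen_cat.
by case: (wlen _ _) => // m; case: (wlen _ _).
Qed.

Lemma dim_split s j : dim s = (dim (front s j) + dim (back s j))%N.
Proof. by rewrite /dim -size_cat cat_take_drop. Qed.

(* On phi of bidegree (k1, l1) and psi of bidegree (k2, l2), the only possibly
   nonzero term is the one of j = k1, and this is the product of the two values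
   on the simplices of dimension k1 + k2 (see [cmul_funE]). *)
Definition cmul_fun (phi psi : simplex -> int) (s : simplex) : int :=
  \sum_(0 <= j < (dim s).+1) phi (front s j) * psi (back s j).

Fact cmul_subproof (f g : cochain) : cmul_fun f g \in fin_bideg.
Proof.
have /asboolP[B hB] := cfunP f; have /asboolP[C hC] := cfunP g.
apply/asboolP.
exists [seq ((b.1 + c.1)%N, (b.2 + c.2)%N) | b <- B, c <- C] => s.
apply: contraR => ns; rewrite /cmul_fun big1 // => j _.
apply/eqP; rewrite mulf_eq0; apply: contraR ns; rewrite negb_or => /andP[hf hg].
apply/allpairsP; exists ((dim (front s j), len (front s j)),
                         (dim (back s j), len (back s j))) => /=.
by split; [apply: hB | apply: hC | rewrite -len_split -dim_split].
Qed.
Definition cmul (f g : cochain) : cochain := Cochain (cmul_subproof f g).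

Definition cunit_fun (s : simplex) : int := (dim s == 0%N)%:R.
Fact cunit_subproof : cunit_fun \in fin_bideg.
Proof.
apply/asboolP; by exists [:: (0%N, 0%N)] => -[[x [|y s]] ?].
Qed.
Definition cunit : cochain := Cochain cunit_subproof.

Lemma dim_front s j : (j <= dim s)%N -> dim (front s j) = j.
Proof. by move=> h; rewrite /dim /= size_takel. Qed.

Lemma dim_back s j : dim (back s j) = (dim s - j)%N.
Proof. by rewrite /dim /= size_drop. Qed.

Lemma front_front s i j : front (front s (i + j)) i = front s i.
Proof.
by apply: val_inj; rewrite /= /wfront /= take_takel // leq_addr.
Qed.

Lemma back_front s i j : back (front s (i + j)) i = front (back s i) j.
Proof.
apply: val_inj; rewrite /= /wfront /wback /= take_takel ?leq_addr //.
by rewrite take_drop addnC.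
Qed.

Lemma back_back s i j : back (back s i) j = back s (i + j).
Proof.
apply: val_inj; rewrite /= /wback /= drop_drop addnC.
by rewrite -last_cat -takeD addnC.
Qed.

Lemma front_all s : front s (dim s) = s.
Proof. by case: s => -[x s] h; apply: val_inj; rewrite /= /wfront take_size. Qed.

Lemma back0 s : back s 0 = s.
Proof. by case: s => -[x s] h; apply: val_inj; rewrite /= /wback take0 drop0. Qed.

Lemma cmul_funE (k1 k2 l1 l2 : nat) (phi psi : simplex -> int) (s : simplex) :
    (forall t, phi t != 0 -> dim t = k1 /\ len t = l1) ->
    (forall t, psi t != 0 -> dim t = k2 /\ len t = l2) ->
  cmul_fun phi psi s =
    if (dim s == k1 + k2)%N && (len (front s k1) == l1) &&
       (len (back s k1) == l2)
    then phi (front s k1) * psi (back s k1) else 0.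
Proof.
move=> h1 h2; case: ifP => [/andP[/andP[/eqP hd _] _]|hn].
  have hk : (k1 <= dim s)%N by rewrite hd leq_addr.
  rewrite /cmul_fun (bigD1_seq k1) ?mem_index_iota ?iota_uniq ?ltnS //=.
  rewrite big_seq_cond big1 ?addr0 // => j.
  rewrite mem_index_iota ltnS => /andP[/andP[_ hj] nj].
  apply/eqP; rewrite mulf_eq0; apply: contraR nj; rewrite negb_or.
  by move=> /andP[/h1[]]; rewrite dim_front // => ->.
rewrite /cmul_fun big_nat big1 // => j /andP[_]; rewrite ltnS => hj.
apply/eqP; rewrite mulf_eq0; apply: contraFT hn; rewrite negb_or.
move=> /andP[/h1[]]; rewrite dim_front // => jk1 hl1 /h2[].
rewrite dim_back => hk2 hl2; rewrite -jk1 -hk2 hl1 hl2 !eqxx !andbT.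
by rewrite subnKC.
Qed.

Fact cmulA : associative cmul.
Proof.
move=> f g h; apply/cochainP => s; rewrite /= /cmul_fun.
pose F i j := f (front s i) * g (front (back s i) j) * h (back s (i + j)).
transitivity (\sum_(0 <= i < (dim s).+1) \sum_(0 <= j < (dim s - i).+1) F i j).
  apply: eq_big_nat => i _; rewrite /= /cmul_fun dim_back big_distrr /=.
  by apply: eq_big_nat => j _; rewrite mulrA back_back.
rewrite -triangular_sum; apply: eq_big_nat => j /andP[_ hj].
rewrite /= /cmul_fun dim_front // big_distrl /=.
apply: eq_big_nat => i /andP[_]; rewrite ltnS => /subnKC; move: (j - i)%N.
by move=> k <-; rewrite /F front_front back_front.
Qed.

Fact cmul1f : left_id cunit cmul.
Proof.
move=> f; apply/cochainP => s; rewrite /= /cmul_fun big_ltn //= big_nat big1.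
  by rewrite /cunit_fun dim_front // mul1r back0 addr0.
move=> j /andP[hj]; rewrite ltnS /cunit_fun => /dim_front->.
by rewrite eqn0Ngt hj mul0r.
Qed.

Fact cmulf1 : right_id cunit cmul.
Proof.
move=> f; apply/cochainP => s; rewrite /= /cmul_fun big_nat_recr //= big_nat big1.
  by rewrite /cunit_fun dim_back subnn front_all mulr1 add0r.
move=> j /andP[_ hj]; rewrite /cunit_fun dim_back.
by rewrite subn_eq0 leqNgt hj mulr0.
Qed.

Fact cmulDl : left_distributive cmul +%R.
Proof.
move=> f g h; apply/cochainP => s; rewrite cochainDE /= /cmul_fun -big_split.
by apply: eq_big_nat => j _; rewrite /= mulrDl.
Qed.

Fact cmulDr : right_distributive cmul +%R.
Proof.
move=> f g h; apply/cochainP => s; rewrite cochainDE /= /cmul_fun -big_split.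
by apply: eq_big_nat => j _; rewrite /= mulrDr.
Qed.

HB.instance Definition _ := GRing.Zmodule_isPzRing.Build cochain
  cmulA cmul1f cmulf1 cmulDl cmulDr.

Definition cobdry_fun (phi : simplex -> int) (s : simplex) : int :=
  fglift (phi : simplex -> int^o) (bdry << s >>).

Lemma bdryU s : bdry << s >> = bdry_simplex s.
Proof. by rewrite /bdry liftU scale1r. Qed.

Definition ext0 (phi : simplex -> int) (w : T * seq T) : int :=
  if insub w is Some s then phi s else 0.

Definition wcobdry (F : T * seq T -> int) (w : T * seq T) : int :=
  \sum_(1 <= i < size w.2)
     (-1) ^+ i * (if smooth_at w i then F (wface w i) else 0).

Lemma cobdry_funE phi s : cobdry_fun phi s = wcobdry (ext0 phi) (val s).
Proof.
rewrite /cobdry_fun bdryU /bdry_simplex /wcobdry raddf_sum /=.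
apply: eq_bigr => i _; rewrite linearZ /= -[LHS]/(_ * _); congr (_ * _).
rewrite /face /ext0; case: ifP => _; last by rewrite raddf0.
by case: insubP => [t _ _|_]; rewrite ?raddf0 // liftU scale1r.
Qed.

Lemma wordP (w : T * seq T) i : (0 < i < size w.2)%N ->
  exists x a y z b, w = (x, a ++ [:: y, z & b]) /\ i = (size a).+1.
Proof.
case: w => x s /= /andP[i0 hi].
exists x, (take i.-1 s), (nth x s i.-1), (nth x s i), (drop i.+1 s).
have hi' : (i.-1 < size s)%N by rewrite (leq_ltn_trans (leq_pred _)).
rewrite size_takel ?prednK //; last exact: ltnW.
split => //; congr pair; rewrite -(drop_nth x hi) -[in LHS](cat_take_drop i.-1 s).
by rewrite (drop_nth x hi') prednK.
Qed.

Lemma wfaceE x a y z b :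
  wface (x, a ++ [:: y, z & b]) (size a).+1 = (x, a ++ z :: b).
Proof. by rewrite /wface /= take_size_cat // -cat_rcons drop_size_cat ?size_rcons. Qed.

Lemma smooth_atE x a y z b :
  smooth_at (x, a ++ [:: y, z & b]) (size a).+1 =
  (d (last x a) z == oaddn (d (last x a) y) (d y z)).
Proof.
rewrite /smooth_at /vertex /=.
have -> : nth x (x :: a ++ [:: y, z & b]) (size a) = last x a.
  by rewrite -cat_cons nth_cat /= ltnSn -last_nth.
have -> : nth x (a ++ [:: y, z & b]) (size a) = y.
  by rewrite nth_cat ltnn subnn.
have -> // : nth x (a ++ [:: y, z & b]) (size a).+1 = z.
by rewrite nth_cat ltnNge leqnSn /= subSnn.
Qed.

Lemma wface_wlen w i : (0 < i < size w.2)%N -> smooth_at w i ->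
  wlen (wface w i).1 (wface w i).2 = wlen w.1 w.2.
Proof.
move=> /wordP[x [a [y [z [b [-> ->]]]]]].
rewrite smooth_atE wfaceE /= => /eqP h.
rewrite !wlen_cat /= h; case: (wlen x a) => //= m.
case: (d _ y) => //= p; case: (d y z) => //= q; case: (wlen z b) => //= r.
by rewrite !addnA.
Qed.

Lemma wface_simplex w i : (forall x, d x x = Some 0%N) ->
    (forall x y, d x y = Some 0%N -> x = y) ->
  is_simplex w -> (0 < i < size w.2)%N -> smooth_at w i ->
  is_simplex (wface w i).
Proof.
move=> d0 d1 hw hi hs; rewrite /is_simplex wface_wlen //.
case/andP: hw => hp hl; rewrite hl andbT.
have [x [a [y [z [b [ew ei]]]]]] := wordP hi.
move: hp hs; rewrite ew ei smooth_atE wfaceE /= !cat_path /=.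
move=> /and4P[-> hay _ ->] /eqP h; rewrite andbT /=.
apply: contraNN hay => /eqP eaz; move: h; rewrite eaz d0.
case E1: (d z y) => [p|] //; case: (d y z) => [q|] //= [/esym/eqP].
by rewrite addn_eq0 => /andP[/eqP p0 _]; apply/eqP/d1; rewrite E1 p0.
Qed.

Fact cobdry_subproof (f : cochain) : cobdry_fun f \in fin_bideg.
Proof.
have /asboolP[B hB] := cfunP f; apply/asboolP.
exists [seq (b.1.+1, b.2) | b <- B] => s; rewrite cobdry_funE.
apply: contraR => ns; rewrite /wcobdry big_nat big1 // => i hi.
case: ifP => hs; last by rewrite mulr0.
rewrite /ext0; case: insubP => [t _ et|_]; last by rewrite mulr0.
apply/eqP; rewrite mulf_eq0; apply/orP; right.
apply: contraR ns => /hB ht; apply/mapP; exists (dim t, len t) => //=.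
have -> : len t = len s by rewrite /len et wface_wlen.
congr pair; rewrite /dim et.
have [x [a [y [z [b [-> ->]]]]]] := wordP hi.
rewrite wfaceE /= !size_cat /=.
by rewrite !addnS.
Qed.
Definition cobdry (f : cochain) : cochain := Cochain (cobdry_subproof f).

Lemma cobdry_bdry (f : cochain) (c : {freeg simplex / int}) :
  fglift (cobdry f : simplex -> int^o) c =
  fglift (f : simplex -> int^o) (bdry c).
Proof.
rewrite -[c]freeg_sumE /bdry !raddf_sum; apply: eq_bigr => s _ /=.
by rewrite !liftU linearZ /= /cobdry_fun bdryU.
Qed.

Definition wmul (F G : T * seq T -> int) (w : T * seq T) : int :=
  \sum_(0 <= j < (size w.2).+1) F (wfront w j) * G (wback w j).

Definition wtwist (F : T * seq T -> int) (w : T * seq T) : int :=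
  (-1) ^+ size w.2 * F w.

Lemma ext0_val phi s : ext0 phi (val s) = phi s.
Proof. by rewrite /ext0 valK. Qed.

Lemma ext0_cmul (f g : cochain) w :
  ext0 (cmul f g) w = wmul (ext0 f) (ext0 g) w.
Proof.
rewrite {1}/ext0; case: insubP => [s _ <-|nw].
  by rewrite /= /cmul_fun /wmul; apply: eq_bigr => j _;
     rewrite -!ext0_val.
rewrite /wmul big1 // => j _; move: nw; rewrite (is_simplex_split w j) negb_and.
by case/orP => h; rewrite /ext0 (insubN _ h) ?mul0r ?mulr0.
Qed.

Lemma wfrontE x (a b : seq T) : wfront (x, a ++ b) (size a) = (x, a).
Proof. by rewrite /wfront /= take_size_cat. Qed.

Lemma wbackE x (a b : seq T) : wback (x, a ++ b) (size a) = (last x a, b).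
Proof. by rewrite /wback /= take_size_cat // drop_size_cat. Qed.

Lemma wface_after w i j : (0 < i < size w.2)%N -> (j < i)%N ->
  [/\ wfront (wface w i) j = wfront w j,
      wback (wface w i) j = wface (wback w j) (i - j)
    & smooth_at w i = smooth_at (wback w j) (i - j)].
Proof.
move=> /wordP[x [a [y [z [b [-> ->]]]]]]; rewrite ltnS => hj.
rewrite -(cat_take_drop j a); move: (take j a) (size_takel hj) (drop j a).
move=> a1 <- a2; rewrite wfaceE size_cat -addnS addKn -!catA.
rewrite !wfrontE !wbackE wfaceE smooth_atE -last_cat; split=> //.
by rewrite catA addnS -size_cat smooth_atE.
Qed.

Lemma wface_before w i j : (0 < i < size w.2)%N -> (i <= j < size w.2)%N ->
  [/\ wfront (wface w i) j = wface (wfront w j.+1) i,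
      wback (wface w i) j = wback w j.+1
    & smooth_at w i = smooth_at (wfront w j.+1) i].
Proof.
move=> /wordP[x [a [y [z [b [-> ->]]]]]]; rewrite /= size_cat /= => /andP[h1 h2].
have hk : (j - (size a).+1 <= size b)%N.
  by rewrite leq_subLR; move: h2; rewrite !addnS addSn ltnS.
rewrite -(cat_take_drop (j - (size a).+1) b).
move: (take _ b) (size_takel hk) (drop _ b) => b1 hb b2.
have -> : j = size (a ++ z :: b1) by rewrite size_cat /= hb addnS -addSn subnKC.
rewrite wfaceE.
have -> : a ++ z :: b1 ++ b2 = (a ++ z :: b1) ++ b2 by rewrite -catA.
have -> : a ++ [:: y, z & b1 ++ b2] = (a ++ [:: y, z & b1]) ++ b2.
  by rewrite -catA.
have -> : (size (a ++ z :: b1)).+1 = size (a ++ [:: y, z & b1]).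
  by rewrite !size_cat /= -addnS.
rewrite !wfrontE !wbackE wfaceE; split=> //.
  by rewrite !last_cat.
by rewrite -catA /= !smooth_atE.
Qed.

Lemma wcobdry_small F w : (size w.2 <= 1)%N -> wcobdry F w = 0.
Proof. by move=> h; rewrite /wcobdry big_geq. Qed.

Lemma wleibniz F G w : wcobdry (wmul F G) w =
  wmul (wcobdry F) G w + wmul (wtwist F) (wcobdry G) w.
Proof.
set n := size w.2.
pose A i j : int := (-1) ^+ i *
  (if smooth_at w i then F (wfront (wface w i) j) * G (wback (wface w i) j)
   else 0).
have size_face i : (0 < i < n)%N -> (size (wface w i).2).+1 = n.
  rewrite /n => /wordP[x [a [y [z [b [-> ->]]]]]].
  by rewrite wfaceE /= !size_cat /= !addnS.
have size_front j : (j <= n)%N -> size (wfront w j).2 = j.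
  by move=> h; rewrite /= size_takel.
have size_back j : size (wback w j).2 = (n - j)%N by rewrite /= size_drop.
have -> : wmul (wcobdry F) G w =
    \sum_(1 <= i < n) \sum_(0 <= j < n | (i <= j)%N) A i j.
  rewrite (exchange_big_dep_nat xpredT) //= /wmul -/n big_nat_recl //=.
  rewrite wcobdry_small /= ?take0 // mul0r add0r.
  apply: eq_big_nat => j /andP[_ hj]; rewrite /wcobdry size_front //.
  rewrite big_distrl /= (big_nat_widen _ _ n) //.
  rewrite big_nat_cond [RHS]big_nat_cond; apply: eq_big => i; first by rewrite ltnS.
  move=> /andP[/andP[i0 hi] ij].
  rewrite /A; have [||-> -> ->] := @wface_before w i j; rewrite -?/n ?i0 ?hi ?hj ?andbT //.
  by rewrite -mulrA; congr (_ * _); case: ifP; rewrite ?mul0r.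
have -> : wmul (wtwist F) (wcobdry G) w =
    \sum_(1 <= i < n) \sum_(0 <= j < n | (j < i)%N) A i j.
  rewrite (exchange_big_dep_nat xpredT) //= /wmul -/n big_nat_recr //=.
  rewrite [X in _ * X]wcobdry_small ?mulr0 ?addr0 /= ?drop_size //.
  apply: eq_big_nat => j /andP[_ hj].
  rewrite /wcobdry size_back big_distrr /=.
  rewrite [RHS](big_cat_nat (n := j.+1)) //= [X in _ = X + _]big_nat_cond.
  rewrite [X in _ = X + _]big_pred0 ?add0r; last first.
    by move=> i; apply/negP => /andP[/andP[_ h1] h2]; move: h1; rewrite ltnS leqNgt h2.
  rewrite -[j.+1]add1n big_addn big_nat_cond [RHS]big_nat_cond.
  apply: eq_big => i.
    by rewrite leq_add2r; case: (0 < i)%N; rewrite ?andbT ?andbF.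
  move=> /andP[/andP[i0 hi] _].
  have hij : (0 < i + j < n)%N by move: hi; rewrite ltn_subRL addnC addn_gt0 i0.
  rewrite /A /wtwist size_front ?(ltnW hj) //.
  have hj' : (j < i + j)%N by rewrite -[X in (X < _)%N]add0n ltn_add2r.
  have [-> -> ->] := wface_after hij hj'; rewrite addnK.
  rewrite exprD; case: ifP; rewrite ?mulr0 // => _.
  by rewrite mulrACA [_ ^+ j * _]mulrC.
rewrite -big_split /=; apply: eq_big_nat => i hi.
rewrite /wmul size_face //.
transitivity (\sum_(0 <= j < n) A i j).
  rewrite /A -big_distrr /=; congr (_ * _).
  by case: ifP; rewrite // big1.
rewrite (bigID (fun j => i <= j)%N) /=; congr (_ + _).
by apply: eq_bigl => j; rewrite ltnNge.
Qed.

Fact ctwist_subproof (f : cochain) :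
  (fun s => (-1) ^+ dim s * f s) \in fin_bideg.
Proof.
have /asboolP[B hB] := cfunP f; apply/asboolP; exists B => s.
by rewrite mulf_eq0 negb_or => /andP[_ /hB].
Qed.
Definition ctwist (f : cochain) : cochain := Cochain (ctwist_subproof f).

Lemma cobdryM (f g : cochain) :
  cobdry (f * g) = cobdry f * g + ctwist f * cobdry g.
Proof.
apply/cochainP => s; rewrite cochainDE /= cobdry_funE.
have -> : ext0 (f * g) = wmul (ext0 f) (ext0 g).
  by apply/funext => w; exact: ext0_cmul.
rewrite wleibniz; congr (_ + _); apply: eq_bigr => j _.
  by rewrite -[g _]ext0_val /= cobdry_funE.
by rewrite /= cobdry_funE -[f _]ext0_val.
Qed.

Lemma cobdryB (f g : cochain) : cobdry (f - g) = cobdry f - cobdry g.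
Proof.
apply/cochainP => s; rewrite cochainBE /= !cobdry_funE /wcobdry -sumrB.
apply: eq_bigr => i _; rewrite -mulrBr; congr (_ * _).
by case: ifP; rewrite ?subr0 // => _; rewrite /ext0; case: insub => //; rewrite subr0.
Qed.

Lemma cobdry1 : cobdry 1 = 0.
Proof.
apply/cochainP => s; rewrite /= cobdry_funE /wcobdry big_nat big1 // => i hi.
case: ifP => _; rewrite ?mulr0 // /ext0; case: insubP => [t _ et|_]; rewrite ?mulr0 //.
rewrite /= /cunit_fun /dim et; have [x [a [y [z [b [-> ->]]]]]] := wordP hi.
by rewrite wfaceE /= size_cat addnS mulr0.
Qed.

Definition is_cocycle : {pred cochain} := fun f => cobdry f == 0.

Fact is_cocycle_subring : subring_closed is_cocycle.
Proof.
split; first by apply/eqP; exact: cobdry1.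
  move=> f g /eqP hf /eqP hg; apply/eqP.
  by rewrite cobdryB hf hg subr0.
move=> f g /eqP hf /eqP hg; apply/eqP.
by rewrite cobdryM hf hg mul0r mulr0 addr0.
Qed.

Record cocycle := Cocycle {
  cocycle_val :> cochain;
  cocycleP : cocycle_val \in is_cocycle
}.
HB.instance Definition _ := [isSub for cocycle_val].
HB.instance Definition _ := [Choice of cocycle by <:].
HB.instance Definition _ :=
  GRing.SubChoice_isSubPzRing.Build cochain is_cocycle cocycle
    is_cocycle_subring.

Definition is_coboundary : {pred cocycle} := fun z =>
  `[< exists f : cochain, cobdry f = cocycle_val z >].

Lemma ctwist_cocycle (f : cochain) : f \in is_cocycle -> ctwist f \in is_cocycle.
Proof.
move=> /eqP hf; apply/eqP/cochainP => s; move/cochainP/(_ s): hf.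
rewrite /= !cobdry_funE /wcobdry => hf.
rewrite big_nat (eq_bigr (fun i => (-1) ^+ (dim s).-1 * ((-1) ^+ i *
  (if smooth_at (val s) i then ext0 f (wface (val s) i) else 0)))).
  by rewrite -big_nat -big_distrr /= hf mulr0.
move=> i hi; rewrite mulrCA; congr (_ * _); case: ifP => _; rewrite ?mulr0 //.
rewrite /ext0; case: insubP => [t _ et|_]; rewrite ?mulr0 //=.
congr (_ ^+ _ * _); rewrite /dim et.
have [x [a [y [z [b [-> ->]]]]]] := wordP hi.
by rewrite wfaceE /= !size_cat /= !addnS.
Qed.

Lemma ctwistK : involutive ctwist.
Proof. by move=> f; apply/cochainP => s; rewrite /= signrMK. Qed.

Fact is_coboundary_ideal : two_sided_ideal is_coboundary.
Proof.
split.
- apply/asboolP; exists 0; have := cobdryB 0 0; rewrite subr0 => ->.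
  by rewrite subrr.
- move=> x y /asboolP[f hf] /asboolP[g hg]; apply/asboolP; exists (f - g).
  by rewrite cobdryB hf hg.
- move=> a x /asboolP[f hf]; apply/asboolP.
  exists (ctwist (cocycle_val a) * f).
  rewrite cobdryM ctwistK hf.
  by have /eqP-> := ctwist_cocycle (cocycleP a); rewrite mul0r add0r.
- move=> a x /asboolP[f hf]; apply/asboolP; exists (f * cocycle_val a).
  by rewrite cobdryM hf; have /eqP-> := cocycleP a; rewrite mulr0 addr0.
Qed.

Definition coboundary_ideal : ideal2 cocycle := Ideal2 is_coboundary_ideal.

Definition MHring : pzRingType := ring_quot coboundary_ideal.

(* [cocycle] is the group of cocycles of a direct sum of complexes, so the
   summand MH^k_l of [MHring] is formed by the classes of the cocycles which are
   concentrated in bidegree (k, l). *)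
Definition MH_part (k l : nat) (x : MHring) : Prop :=
  exists2 z : cocycle,
    forall s, z s != 0 -> dim s = k /\ len s = l
  & x = \pi_(ring_quot coboundary_ideal) z.

End Magnitude.

Definition diagonal (T : finType) (e : rel T) : Prop :=
  forall k l : nat, k != l -> MH_vanishes (gdist e) k l.

Section PathAlgebra.
Variables (T : finType) (e : rel T).

Definition epath : Type := {w : T * seq T | path e w.1 w.2}.
HB.instance Definition _ := Choice.on epath.
HB.instance Definition _ := SubType.on epath.

Definition path_algebra : Type := {freeg epath / int}.
HB.instance Definition _ := GRing.Lmodule.on path_algebra.

(* 0 when w is not an edge path: this case does not occur in [pmul_basis], [pone]
   and [path_relation]. *)
Definition pelt (w : T * seq T) : path_algebra :=
  if insub w is Some p then << p >> else 0.

Definition pmul_basis (p q : epath) : path_algebra :=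
  if last (val p).1 (val p).2 == (val q).1
  then pelt ((val p).1, (val p).2 ++ (val q).2) else 0.

Definition pmul (a b : path_algebra) : path_algebra :=
  fglift (fun p => fglift (pmul_basis p) b) a.

Definition pone : path_algebra := \sum_x pelt (x, [::]).

Lemma pa_ind (P : path_algebra -> Prop) :
  P 0 -> (forall c a b, P a -> P b -> P (c *: a + b)) ->
  (forall p, P (<< p >>)) -> forall a, P a.
Proof.
move=> P0 PD PU a; rewrite -[a]freeg_sumE; elim: (dom a) => [|p s IH].
  by rewrite big_nil.
rewrite big_cons; have -> : << coeff p a *g p >> = coeff p a *: << p >>.
  by apply/eqP/freeg_eqP => y; rewrite coeffZ !coeffU mul1r.
exact: PD.
Qed.

Lemma pmulPl c a a' b : pmul (c *: a + a') b = c *: pmul a b + pmul a' b.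
Proof. by rewrite /pmul linearP. Qed.

Lemma pmulPr c a b b' : pmul a (c *: b + b') = c *: pmul a b + pmul a b'.
Proof.
elim/pa_ind: a => [|k a a' IH IH'|p].
- by rewrite /pmul !linear0 ?scaler0 addr0.
- by rewrite !pmulPl IH IH' !scalerDr !scalerA mulrC addrACA.
- by rewrite /pmul !liftU !scale1r linearP.
Qed.

Lemma pmul0l b : pmul 0 b = 0.
Proof. by rewrite /pmul linear0. Qed.

Lemma pmul0r a : pmul a 0 = 0.
Proof. by have := pmulPr (-1) a 0 0; rewrite scaler0 addr0 scaleN1r addNr. Qed.

Lemma peltE (p : epath) : pelt (val p) = << p >>.
Proof. by rewrite /pelt valK. Qed.

Lemma pmulUU p q : pmul << p >> << q >> = pmul_basis p q.
Proof. by rewrite /pmul !liftU !scale1r. Qed.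

Lemma pmul_pelt w v : pmul (pelt w) (pelt v) =
  if [&& path e w.1 w.2, path e v.1 v.2 & last w.1 w.2 == v.1]
  then pelt (w.1, w.2 ++ v.2) else 0.
Proof.
rewrite {1}/pelt; case: insubP => [p -> <-|/negbTE->]; last exact: pmul0l.
rewrite {1}/pelt; case: insubP => [q -> <-|/negbTE->]; last exact: pmul0r.
exact: pmulUU.
Qed.

Fact pmulA : associative pmul.
Proof.
elim/pa_ind => [|k a a' IH IH'|p] b c; first by rewrite !pmul0l.
  by rewrite !pmulPl IH IH'.
elim/pa_ind: b => [|k b b' IH IH'|q]; first by rewrite pmul0l pmul0r pmul0l.
  by rewrite pmulPl !pmulPr pmulPl IH IH'.
elim/pa_ind: c => [|k c c' IH IH'|r]; first by rewrite !pmul0r.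
  by rewrite !pmulPr IH IH'.
rewrite -!peltE !pmul_pelt !(valP p, valP q, valP r) /=.
case: (eqVneq (last (val q).1 _)) => hqr; case: (eqVneq (last (val p).1 _)) => hpq;
  rewrite ?pmul0l ?pmul0r // !pmul_pelt /= ?(valP p, valP r) /= ?cat_path ?last_cat.
- by rewrite hpq hqr !eqxx (valP p) (valP q) (valP r) catA.
- by rewrite (negbTE hpq) !andbF.
- by rewrite hpq (negbTE hqr) !andbF.
Qed.

Fact pmul1a : left_id pone pmul.
Proof.
elim/pa_ind => [|k a a' IH IH'|p]; first exact: pmul0r.
  by rewrite pmulPr IH IH'.
rewrite -!peltE /pmul /pone linear_sum /= -/(pmul _ _) (bigD1 (val p).1) //=.
rewrite -[fglift _ _]/(pmul _ _) pmul_pelt /= (valP p) eqxx -surjective_pairing.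
rewrite big1 ?addr0 // => x /negbTE nx.
by rewrite -[fglift _ _]/(pmul _ _) pmul_pelt /= nx andbF.
Qed.

Fact pmula1 : right_id pone pmul.
Proof.
elim/pa_ind => [|k a a' IH IH'|p]; first exact: pmul0l.
  by rewrite pmulPl IH IH'.
have -> : pmul << p >> pone = \sum_x pmul << p >> (pelt (x, [::])).
  rewrite /pone; elim/big_rec2: _ => [|x a b _ <-]; first exact: pmul0r.
  by have := pmulPr 1 << p >> (pelt (x, [::])) b; rewrite !scale1r.
rewrite (bigD1 (last (val p).1 (val p).2)) //= big1 ?addr0 => [|x nx].
  by rewrite -peltE pmul_pelt /= (valP p) eqxx cats0 -surjective_pairing.
by rewrite -peltE pmul_pelt /= eq_sym (negbTE nx) andbF.
Qed.

Fact pmulDl : left_distributive pmul +%R.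
Proof. by move=> a b c; have := pmulPl 1 a b c; rewrite !scale1r. Qed.

Fact pmulDr : right_distributive pmul +%R.
Proof. by move=> a b c; have := pmulPr 1 a b c; rewrite !scale1r. Qed.

HB.instance Definition _ := GRing.Zmodule_isPzRing.Build path_algebra
  pmulA pmul1a pmula1 pmulDl pmulDr.

Definition path_relation (r : path_algebra) : Prop :=
  exists x z : T, gdist e x z = Some 2%N /\
    r = \sum_(y | (gdist e x y == Some 1%N) && (gdist e y z == Some 1%N))
          pelt (x, [:: y; z]).

Definition path_ideal : ideal2 path_algebra := gen_ideal path_relation.

Definition path_quot : pzRingType := ring_quot path_ideal.

Definition path_quot_part (k : nat) (x : path_quot) : Prop :=
  exists2 a : path_algebra,
    forall p, p \in dom a -> size (val p).2 = k
  & x = \pi_(ring_quot path_ideal) a.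

End PathAlgebra.

(* Main.v *)
Require Import Defs.
From mathcomp Require Import all_boot all_order all_algebra.
From HB Require Import structures.
From mathcomp Require Import boolp freeg zify.

(** The simplices (x0, .., xk) of length k are exactly the edge paths of length
    k, so the cochains supported on the diagonal k = l are, through the dual
    basis, the elements of the path algebra; the cup product of two dual basis
    elements is dual to the concatenation of the paths. A simplex has length at
    least its dimension, hence a diagonal cochain is always a cocycle. This gives
    a ring morphism [dual] from the path algebra to the ring of cocycles, and the
    theorem says that it becomes an isomorphism once the source is divided by the
    relations and the target by the coboundaries ([quotient_iso]).

    The kernel ([dual_kernel]). A diagonal coboundary is a combination of
    coboundaries of simplices t with dim t = len t - 1. Such a t consists of
    edges and of one pair u, z at distance 2, and its coboundary is, up to sign,
    the sum over all midpoints y of the paths obtained by inserting y between u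
    and z: this is a path, times the relation of (u, z), times a path. So
    diagonal coboundaries correspond to elements of the ideal of relations
    ([wcobdry_sum_ideal]). Conversely the relation of (x, z) is minus the
    coboundary of the cochain dual to (x, z) ([dual_relation]), and coboundaries
    form an ideal.

    Surjectivity ([dual_surj]). Every cocycle must be cohomologous to its
    diagonal part. Homology vanishes off the diagonal and the chain groups are
    free, so a contracting homotopy h with bdry h + h bdry = 1 off the diagonal
    can be built by induction on the dimension ([bdry_contraction]). The
    off-diagonal part f' of a cocycle is then the coboundary of f' o h
    ([cocycle_diag_part]). The induction requires that the square of the
    differential is zero, which rests on the triangle inequality ([wcobdryK]). *)

Set Implicit Arguments.
Unset Strict Implicit.
Unset Printing Implicit Defensive.

Import GRing.Theory.

(* The dimension of a simplex, not of a vector space. *)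
Local Notation dim := Defs.dim.

(** * Isomorphisms between quotient rings *)

Section QuotientIso.
Local Open Scope ring_scope.
Local Open Scope quotient_scope.

(** By the hypotheses u induces an isomorphism from A / I to B / J. Its
    inverse f sends a class to the class of any a such that u a represents it.
    *)
Lemma quotient_iso (A B : pzRingType) (I : ideal2 A) (J : ideal2 B)
    (u : {rmorphism A -> B}) :
    (forall a, (u a \in J) = (a \in I)) ->
    (forall b, exists a, b - u a \in J) ->
  exists f : {rmorphism ring_quot J -> ring_quot I},
    bijective f /\ forall a, f (\pi_(ring_quot J) (u a)) = \pi_(ring_quot I) a.
Proof.
move=> kerE surj.
have piu_surj (x : ring_quot J) : exists a, \pi_(ring_quot J) (u a) = x.
  elim/quotW: x => b; have [a hab] := surj b.
  by exists a; apply/esym/eqP; rewrite ring_quotE.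
have piu_eq a a' : (\pi_(ring_quot J) (u a) == \pi_(ring_quot J) (u a')) =
    (\pi_(ring_quot I) a == \pi_(ring_quot I) a').
  by rewrite !ring_quotE -rmorphB kerE.
pose f0 x := \pi_(ring_quot I) (projT1 (cid (piu_surj x))).
have f0E a : f0 (\pi_(ring_quot J) (u a)) = \pi_(ring_quot I) a.
  by apply/eqP; rewrite -piu_eq; case: cid => a' /= ->.
have fB : zmod_morphism f0.
  move=> x y; have [a <-] := piu_surj x; have [b <-] := piu_surj y.
  have subE (R : pzRingType) (K : ideal2 R) (c d : R) :
      \pi_(ring_quot K) c - \pi_(ring_quot K) d = \pi_(ring_quot K) (c - d).
    by apply/eqP; rewrite subr_eq pi_rq_add subrK.
  by rewrite subE -rmorphB !f0E subE.
have fM : monoid_morphism f0.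
  split; first by rewrite -[1]/(\pi_(ring_quot J) 1) -(rmorph1 u) f0E.
  move=> x y; have [a <-] := piu_surj x; have [b <-] := piu_surj y.
  by rewrite -[_ * _]/(rq_mul _ _) pi_rq_mul -rmorphM !f0E -pi_rq_mul.
pose fA := GRing.isZmodMorphism.Build _ _ f0 fB.
pose fMM := GRing.isMonoidMorphism.Build _ _ f0 fM.
pose f : {rmorphism ring_quot J -> ring_quot I} := HB.pack f0 fA fMM.
exists f; split=> //.
exists (fun y => \pi_(ring_quot J) (u (repr y))) => [x|y]; last first.
  by rewrite -[LHS]/(f0 _) f0E reprK.
have [a <-] := piu_surj x; apply/eqP.
by rewrite piu_eq reprK -[f _]/(f0 _) f0E.
Qed.

End QuotientIso.

(** * Linear maps and supports on free groups *)

Section FreeSupport.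
Local Open Scope ring_scope.
Variable K : choiceType.

Lemma fgliftE (M : lmodType int) (f : K -> M) (c : {freeg K / int}) :
  fglift f c = \sum_(s <- dom c) coeff s c *: f s.
Proof.
rewrite -[c in LHS]freeg_sumE raddf_sum; apply: eq_bigr => s _ /=.
by rewrite liftU.
Qed.

Lemma eq_fglift (M : lmodType int) (f g : K -> M) (c : {freeg K / int}) :
  {in dom c, f =1 g} -> fglift f c = fglift g c.
Proof. by move=> fg; rewrite !fgliftE; apply: eq_big_seq => s /fg->. Qed.

Lemma fglift_comp (L : choiceType) (M : lmodType int) (g : L -> M)
    (f : K -> {freeg L / int}) (c : {freeg K / int}) :
  fglift g (fglift f c) = fglift (fun s => fglift g (f s)) c.
Proof.
rewrite fgliftE linear_sum fgliftE; apply: eq_bigr => s _.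
by rewrite linearZ.
Qed.

Lemma fglift_unit (c : {freeg K / int}) :
  fglift (fun s => << s >> : {freeg K / int}) c = c.
Proof.
rewrite fgliftE -[RHS]freeg_sumE; apply: eq_bigr => s _.
by apply/eqP/freeg_eqP => t; rewrite coeffZ !coeffU mul1r.
Qed.

Lemma fgliftB (M : lmodType int) (f g : K -> M) (c : {freeg K / int}) :
  fglift (fun s => f s - g s) c = fglift f c - fglift g c.
Proof.
by rewrite !fgliftE -sumrB; apply: eq_bigr => s _; rewrite scalerBr.
Qed.

Definition supported (P : K -> Prop) (c : {freeg K / int}) : Prop :=
  forall s, s \in dom c -> P s.

Lemma supported0 P : supported P 0.
Proof. by move=> s; rewrite dom0. Qed.

Lemma supportedU P s : P s -> supported P << s >>.
Proof. by move=> Ps t; rewrite domU1 inE => /eqP->. Qed.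

Lemma supportedZ P k c : supported P c -> supported P (k *: c).
Proof. by move=> Pc s /domZ_subset/Pc. Qed.

Lemma supportedD P c c' : supported P c -> supported P c' -> supported P (c + c').
Proof. by move=> Pc Pc' s /domD_subset; rewrite mem_cat => /orP[/Pc|/Pc']. Qed.

Lemma supportedB P c c' : supported P c -> supported P c' -> supported P (c - c').
Proof.
move=> Pc Pc'; apply: supportedD => //.
by rewrite -scaleN1r; apply: supportedZ.
Qed.

Lemma supported_sum P (I : eqType) (r : seq I) (F : I -> {freeg K / int}) :
  (forall i, i \in r -> supported P (F i)) -> supported P (\sum_(i <- r) F i).
Proof.
move=> PF; rewrite big_seq; elim/big_rec: _ => [|i c ri Pc].
  exact: supported0.
by apply: supportedD; first apply: PF.
Qed.

End FreeSupport.

Lemma supported_fglift (K L : choiceType) (P : L -> Prop)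
    (f : K -> {freeg L / int}) (c : {freeg K / int}) :
  (forall s, s \in dom c -> supported P (f s)) -> supported P (fglift f c).
Proof.
move=> Pf; rewrite fgliftE; apply: supported_sum => s /Pf.
exact: supportedZ.
Qed.

(** * The square of the coboundary *)

Section DoubleCoboundary.
Local Open Scope ring_scope.
Variables (T : choiceType) (d : T -> T -> option nat).

Definition triangular : Prop := forall x y z m n,
  d x y = Some m -> d y z = Some n -> exists2 k, (k <= m + n)%N & d x z = Some k.

Definition between x y z : bool := d x z == oaddn (d x y) (d y z).

(** Under the triangle inequality both sides say that d x v is the sum of the
    three consecutive distances. Finiteness matters: an infinite d x y makes
    [between x y z] and [between x z v] easy to satisfy, whatever d y v is. *)
Lemma between_exchange x y z v : triangular ->
    d x y != None -> d y z != None -> d z v != None ->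
  between x y z && between x z v = between y z v && between x y v.
Proof.
rewrite /between => tri; case xy: (d x y) => [a|] // _.
case yz: (d y z) => [b|] // _; case zv: (d z v) => [c|] // _.
have [p pab xz] := tri _ _ _ _ _ xy yz; have [q qbc yv] := tri _ _ _ _ _ yz zv.
have [r rpc xv] := tri _ _ _ _ _ xz zv; have [r' raq] := tri _ _ _ _ _ xy yv.
rewrite xv => -[rr']; rewrite -{r'}rr' in raq.
rewrite xz yv /=; apply/andP/andP => -[/eqP[h1] /eqP[h2]];
  split; apply/eqP; congr Some; lia.
Qed.

(** Deleting the second vertex, or deleting a later one with the first vertex
    kept aside: this allows proofs by induction on the word instead of double
    sums over pairs of faces. *)
Lemma wcobdry_cons F x y z s :
  wcobdry d F (x, [:: y, z & s]) =
  - (if between x y z then F (x, z :: s) else 0)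
  - wcobdry d (fun w => F (x, w.1 :: w.2)) (y, z :: s).
Proof.
rewrite /wcobdry big_ltn // mulN1r; congr (_ + _).
rewrite [in LHS]big_add1 /= -sumrN big_nat [RHS]big_nat; apply: eq_bigr => i hi.
have [x' [a [y' [z' [b [ew ei]]]]]] := @wordP _ (y, z :: s) i hi.
have -> : (x, [:: y, z & s]) = (x, (x' :: a) ++ [:: y', z' & b]).
  by case: ew => -> ->.
have [ey es] : wface (y, z :: s) i = (x', a ++ z' :: b).
  by rewrite ew ei wfaceE.
by rewrite es ew ey ei !smooth_atE !wfaceE exprS mulN1r mulNr.
Qed.

Lemma wcobdry_cond (b : bool) F w :
  wcobdry d (fun w => if b then F w else 0) w = if b then wcobdry d F w else 0.
Proof.
case: b => //; rewrite /wcobdry big1 // => i _.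
by case: ifP; rewrite mulr0.
Qed.

Lemma eq_wcobdry F G x s : (forall t, F (x, t) = G (x, t)) ->
  wcobdry d F (x, s) = wcobdry d G (x, s).
Proof. by move=> FG; apply: eq_bigr => i _; rewrite /wface FG. Qed.

Lemma wcobdryB F G w :
  wcobdry d (fun w => F w - G w) w = wcobdry d F w - wcobdry d G w.
Proof.
rewrite /wcobdry -sumrB; apply: eq_bigr => i _; rewrite -mulrBr; congr (_ * _).
by case: ifP => _; rewrite ?subr0.
Qed.

(** Expanding both coboundaries with [wcobdry_cons], all terms cancel in pairs
    or by induction, except the two ways of deleting the second and the third
    vertex, which agree by [between_exchange]. *)
Lemma wcobdryK F w : triangular -> wlen d w.1 w.2 != None ->
  wcobdry d (wcobdry d F) w = 0.
Proof.
move=> tri; case: w => x s /=; elim: s x F => [|y s IH] x F.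
  by move=> _; rewrite wcobdry_small.
case: s IH => [|z s] IH; first by move=> _; rewrite wcobdry_small.
move=> len_fin.
have len_fin' : wlen d y (z :: s) != None.
  by move: len_fin => /=; case: (oaddn (d y z) _); case: (d x y).
rewrite wcobdry_cons.
(* The inner coboundary, with x kept aside, is - F2 - wcobdry F1. *)
pose F1 w := F (x, w.1 :: w.2).
pose F2 w := if w is (y, z :: s) then
  (if between x y z then F (x, z :: s) else 0) else 0.
have -> : (fun w => wcobdry d F (x, w.1 :: w.2)) =
    (fun w => (- F2 w) - wcobdry d F1 w).
  apply/funext => -[u [|v t]] /=; last by rewrite wcobdry_cons.
  by rewrite !wcobdry_small //= oppr0 subr0.
rewrite wcobdryB IH // subr0.
have -> : (fun w => - F2 w) = (fun w => 0 - F2 w).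
  by apply/funext => w; rewrite sub0r.
rewrite wcobdryB (wcobdry_cond false (fun=> 0)) sub0r opprK.
case: s IH len_fin len_fin' => [|v s] _ len_fin _.
  by rewrite !wcobdry_small // if_same oppr0 addr0.
have fin : [/\ d x y != None, d y z != None & d z v != None].
  move: len_fin => /=; case: (d x y) => //= ?; case: (d y z) => //= ?.
  by case: (d z v).
case: fin => xy yz zv; have exch := between_exchange tri xy yz zv.
rewrite [wcobdry d F _]wcobdry_cons -/F1 [wcobdry d F2 _]wcobdry_cons /=.
rewrite (@eq_wcobdry (fun w => F2 (y, w.1 :: w.2))
  (fun w => if between x y z then F1 w else 0)) // wcobdry_cond.
case: (between x y z) exch => /=; case: (between x z v);
  case: (between y z v); case: (between x y v) => //= _;
  rewrite ?oppr0 ?subr0 ?add0r ?opprD ?opprK ?addNr ?subrr //.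
by rewrite -opprD subrr.
Qed.

End DoubleCoboundary.

(** * Cohomology of a diagonal space *)

Section MagnitudeComplex.
Local Open Scope ring_scope.
Variables (T : choiceType) (d : T -> T -> option nat).
Hypothesis dxx : forall x, d x x = Some 0%N.
Hypothesis d_eq0 : forall x y, d x y = Some 0%N -> x = y.
Hypothesis d_tri : triangular d.

Local Notation simplex := (simplex d).
Local Notation chain := {freeg simplex / int}.
Local Notation is_cocycle := (@is_cocycle _ d).

Lemma smooth_face (s : simplex) i : (0 < i < dim s)%N -> smooth_at d (val s) i ->
  exists t : simplex,
    [/\ val t = wface (val s) i, dim s = (dim t).+1 & len t = len s].
Proof.
move=> hi hs; have ss := wface_simplex dxx d_eq0 (valP s) hi hs.
exists (Sub (wface (val s) i) ss).
split; rewrite ?SubK //; last by rewrite /len SubK wface_wlen.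
rewrite /dim SubK; have [x [a [y [z [b [-> ->]]]]]] := wordP hi.
by rewrite wfaceE /= !size_cat /= !addnS.
Qed.

Lemma dim_le_len (s : simplex) : (dim s <= len s)%N.
Proof.
case: s => -[x s] ss; rewrite /dim /len /=.
move: ss; rewrite /is_simplex /=; elim: s x => //= y s IH x.
case xy: (d x y) => [m|] /=; last by rewrite andbF.
move=> /andP[/andP[nxy ps] fin]; have := IH y; rewrite ps.
case: (wlen d y s) fin => [n|] //= _ /(_ isT) hn.
have m0 : (0 < m)%N.
  by case: m xy => // /d_eq0 exy; rewrite exy eqxx in nxy.
lia.
Qed.

Lemma cobdryK (f : cochain d) : cobdry (cobdry f) = 0.
Proof.
apply/cochainP => s; rewrite /= cobdry_funE.
have /andP[_ fin] := valP s.
rewrite -[RHS](wcobdryK (ext0 f) d_tri fin) /wcobdry big_nat [RHS]big_nat.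
apply: eq_bigr => i hi; case: ifP => // hs.
have [t [et _ _]] := smooth_face hi hs.
by rewrite -et ext0_val /= cobdry_funE.
Qed.

Fact delta_subproof (t : simplex) : (fun s => (s == t)%:R) \in fin_bideg (d := d).
Proof.
apply/asboolP; exists [:: (dim t, len t)] => s.
by have [->|] := eqVneq s t; rewrite ?mem_head ?eqxx.
Qed.
Definition delta (t : simplex) : cochain d := Cochain (delta_subproof t).

(** Each coefficient of bdry (bdry c) is the value on c of the double
    coboundary of a dual basis cochain. *)
Lemma bdryK (c : chain) : bdry (bdry c) = 0.
Proof.
apply/eqP/freeg_eqP => t.
rewrite coeff0 -[LHS]/(fglift (delta t : simplex -> int^o) (bdry (bdry c))).
rewrite -!cobdry_bdry cobdryK fgliftE big1 // => s _.
by rewrite scaler0.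
Qed.

Lemma bdry_degree (s : simplex) :
  supported (fun t => dim s = (dim t).+1 /\ len t = len s) (bdry << s >>).
Proof.
rewrite bdryU; apply: supported_sum => i.
rewrite mem_index_iota => hi; apply: supportedZ.
rewrite /face; case: ifP => hs; last exact: supported0.
have [t [et dt lt]] := smooth_face hi hs.
by rewrite -et valK; apply: supportedU.
Qed.

Lemma bdryB : {morph @bdry _ d : c c' / c - c'}.
Proof. by move=> c c'; rewrite /bdry raddfB. Qed.

Lemma bdry_fglift (K : choiceType) (f : K -> chain) (c : {freeg K / int}) :
  bdry (fglift f c) = fglift (fun t => bdry (f t)) c.
Proof. exact: fglift_comp. Qed.

Lemma MC0 k l : MC k l (0 : chain).
Proof. exact: supported0. Qed.

Section Contraction.
Hypothesis diag : forall k l : nat, k != l -> MH_vanishes d k l.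

(** Total, so that the contraction can be defined on all simplices before the
    boundaries of its values are known. *)
Definition bounding (k l : nat) (c : chain) : chain :=
  if pselect (exists2 b, MC k l b & bdry b = c) is left h then s2val (cid2 h)
  else 0.

Lemma bounding_MC k l c : MC k l (bounding k l c).
Proof. by rewrite /bounding; case: pselect => [h|_]; [case: cid2 | apply: MC0]. Qed.

Lemma bdry_bounding k l c :
  k != l -> MC k l c -> bdry c = 0 -> bdry (bounding k.+1 l c) = c.
Proof.
move=> kl hc bc; rewrite /bounding; case: pselect => [h|[]]; first by case: cid2.
exact: diag.
Qed.

(** The recursion is on a bound n of the dimension, because the value at s
    depends on the values at all the faces of s. *)
Fixpoint contraction_rec (n : nat) (s : simplex) : chain :=
  if n is m.+1 then
    bounding (dim s).+1 (len s)
      (<< s >> - fglift (contraction_rec m) (bdry << s >>))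
  else 0.

Definition contraction (s : simplex) : chain := contraction_rec (dim s).+1 s.

Lemma contraction_MC s : MC (dim s).+1 (len s) (contraction s).
Proof. exact: bounding_MC. Qed.

Lemma contractionE s : contraction s =
  bounding (dim s).+1 (len s) (<< s >> - fglift contraction (bdry << s >>)).
Proof.
rewrite {1}/contraction /=; congr (bounding _ _ (_ - _)).
by apply: eq_fglift => t /bdry_degree[-> _].
Qed.

(** The chain <<s>> - h (bdry s) is a cycle because bdry h = 1 - h bdry on
    bdry s, by induction, and bdry (bdry s) = 0; the faces of s are off the
    diagonal, since dim s < len s. So this cycle is a boundary, and h s is
    chosen to bound it. *)
Lemma bdry_contraction s : dim s != len s ->
  bdry (contraction s) = << s >> - fglift contraction (bdry << s >>).
Proof.
have [n] := ubnP (dim s); elim: n s => // n IH s; rewrite ltnS => sn hs.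
rewrite contractionE bdry_bounding //.
  apply: supportedB; first exact: supportedU.
  apply: supported_fglift => t /bdry_degree[-> <-].
  exact: contraction_MC.
rewrite bdryB bdry_fglift.
have -> : fglift (fun t => bdry (contraction t)) (bdry << s >>)
    = fglift (fun t => << t >> - fglift contraction (bdry << t >>)) (bdry << s >>).
  apply: eq_fglift => t /bdry_degree[st lt]; apply: IH.
    by rewrite -st.
  by have := dim_le_len s; rewrite lt; lia.
rewrite fgliftB fglift_unit -fglift_comp -bdry_fglift fglift_unit bdryK.
by rewrite raddf0 subr0 subrr.
Qed.

End Contraction.

Definition on_diagonal (f : cochain d) : Prop :=
  forall s, f s != 0 -> dim s = len s.

(** A simplex with a face t of the same length such that dim t = len t would
    have a dimension larger than its length. *)
Lemma on_diagonal_cocycle f : on_diagonal f -> f \in is_cocycle.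
Proof.
move=> df; apply/eqP/cochainP => s; rewrite /= cobdry_funE /wcobdry.
rewrite big_nat big1 // => i hi; case: ifP => hs; last by rewrite mulr0.
have [t [et dt lt]] := smooth_face hi hs; rewrite -et ext0_val.
have [->|/df ft] := eqVneq (f t) 0; first by rewrite mulr0.
by have := dim_le_len s; rewrite dt -lt ft ltnn.
Qed.

Fact diag_part_subproof (f : cochain d) :
  (fun s => if dim s == len s then f s else 0) \in fin_bideg (d := d).
Proof.
have /asboolP[B hB] := cfunP f; apply/asboolP; exists B => s.
by case: ifP => // _; apply: hB.
Qed.
Definition diag_part (f : cochain d) : cochain d := Cochain (diag_part_subproof f).

Lemma diag_part_on_diagonal f : on_diagonal (diag_part f).
Proof. by move=> s /=; case: (dim s =P len s); rewrite ?eqxx. Qed.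

(** With f' the difference, h the contraction and f' also standing for its
    linear extension, f' = f' (bdry h + h bdry) = (f' h) bdry off the
    diagonal, and both f' and (f' h) bdry vanish on it. *)
Lemma cocycle_diag_part (f : cochain d) :
    (forall k l : nat, k != l -> MH_vanishes d k l) ->
  f \in is_cocycle -> exists g, cobdry g = f - diag_part f.
Proof.
move=> diag fc; set f' := f - diag_part f.
have f'c : cobdry f' = 0.
  have /eqP dc := on_diagonal_cocycle (@diag_part_on_diagonal f).
  by rewrite cobdryB dc (eqP fc) subr0.
have f'diag s : dim s = len s -> f' s = 0.
  by rewrite /f' cochainBE /= => ->; rewrite eqxx subrr.
clearbody f'.
pose ev := fglift (f' : simplex -> int^o).
have g_fin : (fun s => ev (contraction s)) \in fin_bideg (d := d).
  have /asboolP[B hB] := cfunP f'; apply/asboolP.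
  exists [seq (b.1.-1, b.2) | b <- B] => s; apply: contraR => ns.
  rewrite /ev fgliftE big1_seq // => t /andP[_ ht].
  have [dt lt] := contraction_MC ht.
  have [->|/hB hb] := eqVneq (f' t) 0; first by rewrite scaler0.
  by case/mapP: ns; exists (dim t, len t); rewrite //= dt lt.
exists (Cochain g_fin); apply/cochainP => s.
transitivity (fglift (fun t => ev (contraction t) : int^o) (bdry << s >>)) => //.
rewrite -(@fglift_comp _ _ int^o f' contraction).
have [sd|sd] := eqVneq (dim s) (len s).
  have sup : supported (fun t => dim t = len t)
      (fglift contraction (bdry << s >>)).
    apply: supported_fglift => u /bdry_degree[su us] v /contraction_MC[-> ->].
    by rewrite us -su.
  rewrite f'diag // fgliftE big1_seq // => t /andP[_ /sup ht].
  by rewrite f'diag // scaler0.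
have -> : fglift contraction (bdry << s >>) = << s >> - bdry (contraction s).
  by rewrite (bdry_contraction diag sd) opprB addrC subrK.
rewrite raddfB /=.
rewrite liftU scale1r.
have -> : fglift (f' : simplex -> int^o) (bdry (contraction s)) = 0.
  by rewrite -(cobdry_bdry f') f'c fgliftE big1 // => t _; rewrite scaler0.
by rewrite subr0.
Qed.

End MagnitudeComplex.

(** * Distances and edge paths *)

Section GraphDistance.
Variables (T : finType) (e : rel T).
Hypothesis e_irr : irreflexive e.

Local Notation d := (gdist e).

Lemma gdist_le x y n :
  has_path e x y n -> exists2 m, (m <= n)%N & d x y = Some m.
Proof.
move=> xy; rewrite /gdist; case: pselect => [h|[]]; last by exists n.
by case: ex_minnP => m _ /(_ n xy) mn; exists m.
Qed.

Lemma has_path_gdist x y n : d x y = Some n -> has_path e x y n.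
Proof.
by rewrite /gdist; case: pselect => // h [<-]; case: ex_minnP.
Qed.

Lemma gdist_triangular : triangular d.
Proof.
move=> x y z m n /has_path_gdist/existsP[p /andP[xp /eqP py]].
move=> /has_path_gdist/existsP[q /andP[yq /eqP qz]].
apply: gdist_le; apply/existsP; exists (cat_tuple p q).
by rewrite /= cat_path last_cat py xp yq qz eqxx.
Qed.

Lemma gdist_eq1 x y : (d x y == Some 1%N) = e x y.
Proof.
apply/eqP/idP => [/has_path_gdist/existsP[[[|z [|? ?]] //= _]]|xy].
  by rewrite andbT => /andP[xz /eqP<-].
have [|[|[|m]] // _ dxy] := @gdist_le x y 1.
  by apply/existsP; exists [tuple y]; rewrite /= xy eqxx.
by have := e_irr x; rewrite {2}(gdist_eq0 dxy) xy.
Qed.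

Lemma edge_pathE x s :
  path e x s = is_simplex d (x, s) && (wlen d x s == Some (size s)).
Proof.
apply/idP/andP => [|[]].
  suff H : path e x s -> path [rel x y | x != y] x s /\ wlen d x s = Some (size s).
    by move=> /H[h1 h2]; rewrite /is_simplex /= h1 h2.
  elim: s x => //= y s IH x /andP[xy /IH[ps ->]].
  have /eqP -> : d x y == Some 1%N by rewrite gdist_eq1.
  by rewrite ps andbT; split=> //; apply/eqP => exy; rewrite exy e_irr in xy.
elim: s x => //= y s IH x ss /eqP ls; rewrite -gdist_eq1.
have ss' : is_simplex d (y, s).
  by move: ss; rewrite (is_simplex_split _ _ 1) => /andP[_];
    rewrite /wback /= take0 drop0.
have := dim_le_len (@gdist_eq0 _ e) (exist (is_simplex d) _ ss').
rewrite /dim /len /=.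
case xy: (d x y) ls => [m|] //=; case ys: (wlen d y s) => [n|] //= [mn] sn.
have m0 : (0 < m)%N.
  case: m xy {mn} => // /gdist_eq0 exy.
  by move: ss; rewrite /is_simplex /= exy eqxx.
have m1 : m = 1%N by lia.
by rewrite m1 eqxx IH // ys; apply/eqP; congr Some; lia.
Qed.

(** An edge path is a simplex of which all the steps have the least possible
    length 1. *)
Lemma edge_path_len (s : simplex d) :
  path e (val s).1 (val s).2 = (dim s == len s).
Proof.
have := valP s; rewrite edge_pathE -surjective_pairing => ss; rewrite ss /dim /len.
move: ss => /andP[_]; case: (wlen _ _ _) => //= m _.
by rewrite eq_sym.
Qed.

Lemma edge_path_simplex w : path e w.1 w.2 -> is_simplex d w.
Proof. by rewrite edge_pathE -surjective_pairing => /andP[]. Qed.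

End GraphDistance.

(** * Words *)

Section Words.
Local Open Scope ring_scope.
Variable T : finType.

(** Words of length k as lists, not as tuples, so that they can be cut at a
    given place without casts ([big_words_cat]). *)
Fixpoint words (k : nat) : seq (seq T) :=
  if k is j.+1 then [seq y :: s | y <- enum T, s <- words j] else [:: [::]].

Lemma mem_words k s : (s \in words k) = (size s == k).
Proof.
elim: k s => [|k IH] [|y s] //=; first by apply/negbTE/negP => /allpairsP[[? ?] []].
rewrite eqSS -IH; apply/allpairsP/idP => [[[y' s'] [_ /= hs' [_ ->]]] //|hs].
by exists (y, s); rewrite mem_enum.
Qed.

Lemma words_uniq k : uniq (words k).
Proof.
elim: k => //= k IH; apply: allpairs_uniq; rewrite ?enum_uniq //.
by move=> [y s] [y' s'] _ _ /= [-> ->].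
Qed.

Lemma big_wordsS (V : nmodType) k (F : seq T -> V) :
  \sum_(s <- words k.+1) F s = \sum_y \sum_(s <- words k) F (y :: s).
Proof. by rewrite /= big_allpairs_dep big_enum. Qed.

Lemma big_words_cat (V : nmodType) m n (F : seq T -> V) :
  \sum_(s <- words (m + n)) F s =
  \sum_(a <- words m) \sum_(b <- words n) F (a ++ b).
Proof.
elim: m F => [|m IH] F; first by rewrite big_seq1.
rewrite addSn !big_wordsS; apply: eq_bigr => y _; exact: IH.
Qed.

End Words.

(** * Coefficients in the path algebra *)

Section PathCoefficients.
Local Open Scope ring_scope.
Variables (T : finType) (e : rel T).

(** Indexed by arbitrary words, and 0 on those that are not edge paths, so
    that it can be compared with the functions on words which compute products
    and coboundaries of cochains. *)
Definition path_coeff (w : T * seq T) : path_algebra e -> int^o :=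
  fglift (fun p => (val p == w)%:R : int^o).
HB.instance Definition _ w := GRing.Linear.on (path_coeff w).

Lemma path_coeffE a p : path_coeff (val p) a = coeff p a.
Proof. by rewrite /coeff; apply: eq_fglift => q _; rewrite val_eqE. Qed.

Lemma path_coeff_pelt v w :
  path_coeff w (pelt e v) = (path e v.1 v.2 && (v == w))%:R.
Proof.
rewrite /pelt; case: insubP => [p -> <-|/negbTE->]; last by rewrite linear0.
by rewrite /path_coeff liftU scale1r.
Qed.

Lemma path_coeff_eq0 a w : ~~ path e w.1 w.2 -> path_coeff w a = 0.
Proof.
move=> nw; rewrite /path_coeff fgliftE big1 // => p _.
case: eqP => [pw|_]; last by rewrite scaler0.
by rewrite -pw (valP p) in nw.
Qed.

Lemma path_coeff_neq0 a w :
  path_coeff w a != 0 -> exists2 p, p \in dom a & val p = w.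
Proof.
move=> aw; have [pw|/path_coeff_eq0 nw] := boolP (path e w.1 w.2); last first.
  by rewrite nw eqxx in aw.
exists (Sub w pw); last exact: SubK.
by rewrite mem_dom -path_coeffE SubK.
Qed.

Lemma path_algebra_eqP (a b : path_algebra e) :
  (forall w, path e w.1 w.2 -> path_coeff w a = path_coeff w b) -> a = b.
Proof.
move=> ab; apply/eqP/freeg_eqP => p.
by rewrite -!path_coeffE ab // (valP p).
Qed.

Lemma path_coeff1 w : path_coeff w (1 : path_algebra e) = (size w.2 == 0%N)%:R.
Proof.
case: w => x s; rewrite -[1]/(pone e) /pone linear_sum /= (bigD1 x) //=.
rewrite path_coeff_pelt big1 ?addr0 => [|y yx].
  by rewrite /= xpair_eqE eqxx eq_sym; case: s.
by rewrite path_coeff_pelt /= xpair_eqE (negbTE yx).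
Qed.

Lemma path_coeffP k (a b : path_algebra e) w :
  path_coeff w (k *: a + b) = k * path_coeff w a + path_coeff w b :> int.
Proof. exact: linearP. Qed.

(** A path that is a concatenation of p and q can be so in one way only, since
    the length of p determines where it is cut. *)
Lemma path_coeffM (a b : path_algebra e) w :
  path_coeff w (a * b) = wmul (path_coeff^~ a) (path_coeff^~ b) w.
Proof.
rewrite -[a * b]/(pmul a b) /wmul.
elim/pa_ind: a => [|k a a' IH IH'|p].
- by rewrite pmul0l linear0 big1 // => j _; rewrite linear0 mul0r.
- rewrite pmulPl path_coeffP IH IH' mulr_sumr -big_split; apply: eq_bigr => j _.
  by rewrite path_coeffP mulrDl mulrA.
elim/pa_ind: b => [|k b b' IH IH'|q].
- by rewrite pmul0r linear0 big1 // => j _; rewrite linear0 mulr0.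
- rewrite pmulPr path_coeffP IH IH' mulr_sumr -big_split; apply: eq_bigr => j _.
  by rewrite path_coeffP mulrDr mulrCA.
rewrite pmulUU -!peltE /pmul_basis.
under eq_bigr => j _ do
  rewrite !path_coeff_pelt (valP p) (valP q) -natrM mulnb !andTb.
move: (valP p) (valP q); case: (val p) => x s; case: (val q) => y t /= ps qt.
have cut j : (x, s) = wfront w j -> (y, t) = wback w j ->
    last x s = y /\ (x, s ++ t) = w.
  by case: w => u r [-> ->] [-> ->]; rewrite cat_take_drop.
case: eqP => [xsy|xsy]; last first.
  rewrite linear0 big1 // => j _; case: andP => // -[/eqP h1 /eqP h2].
  by case: (cut j h1 h2).
rewrite path_coeff_pelt /= cat_path ps xsy qt /=.
have [<-|nw] := eqVneq (x, s ++ t) w; last first.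
  rewrite big1 // => j _; case: andP => // -[/eqP h1 /eqP h2].
  by case: (cut j h1 h2) => _ ew; rewrite ew eqxx in nw.
rewrite (bigD1_seq (size s)) ?iota_uniq ?mem_index_iota //=; last first.
  by rewrite ltnS size_cat leq_addr.
rewrite wfrontE wbackE xsy !eqxx big_seq_cond big1 ?addr0 // => j.
rewrite mem_index_iota ltnS => /andP[/andP[_ hj] js].
case: andP => // -[/eqP[es] _]; case/eqP: js.
by rewrite es size_takel.
Qed.

(** Words that are not edge paths contribute 0 through [pelt], so the sum runs
    over all words, which form a product. *)
Definition sum_of_length (k : nat) (c : T * seq T -> int) : path_algebra e :=
  \sum_x \sum_(s <- words T k) c (x, s) *: pelt e (x, s).

Definition sum_below (n : nat) (c : T * seq T -> int) : path_algebra e :=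
  \sum_(k < n) sum_of_length k c.

Lemma path_coeff_sum_of_length k c w :
  path_coeff w (sum_of_length k c) =
    if path e w.1 w.2 && (size w.2 == k) then c w else 0.
Proof.
case: w => u t /=.
rewrite linear_sum (bigD1 u) //= [X in _ + X]big1 ?addr0 => [|x xu]; last first.
  rewrite linear_sum big1 // => s _.
  by rewrite linearZ /= path_coeff_pelt xpair_eqE (negbTE xu) andbF scaler0.
rewrite linear_sum /=; have [ht|ht] := boolP (t \in words T k).
  rewrite (bigD1_seq t) ?words_uniq //= big1 ?addr0 => [|s st].
    rewrite linearZ /= path_coeff_pelt eqxx -mem_words ht !andbT.
    by case: path; rewrite ?scaler0 // /GRing.scale /= mulr1.
  by rewrite linearZ /= path_coeff_pelt xpair_eqE (negbTE st) !andbF scaler0.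
rewrite -mem_words (negbTE ht) andbF big1_seq // => s /andP[_ hs].
rewrite linearZ /= path_coeff_pelt xpair_eqE; case: (s =P t) => [st|_].
  by rewrite st (negbTE ht) in hs.
by rewrite !andbF scaler0.
Qed.

Lemma path_coeff_sum_below n c w :
  path_coeff w (sum_below n c) =
    if path e w.1 w.2 && (size w.2 < n)%N then c w else 0.
Proof.
rewrite linear_sum /=; under eq_bigr => k _ do rewrite path_coeff_sum_of_length.
case: path => /=; last by rewrite big1.
case: ltnP => [wn|nw].
  rewrite (bigD1 (Ordinal wn)) //= eqxx big1 ?addr0 // => k.
  by rewrite -val_eqE /= eq_sym => /negbTE->.
by rewrite big1 // => k _; case: eqP => // wk; have := ltn_ord k; rewrite -wk ltnNge nw.
Qed.

End PathCoefficients.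

(** * The dual basis morphism *)

Section DualBasis.
Local Open Scope ring_scope.
Variables (T : finType) (e : rel T).
Hypothesis e_irr : irreflexive e.

Local Notation d := (gdist e).

Lemma dual_on_diagonal (a : path_algebra e) (s : simplex d) :
  path_coeff (val s) a != 0 -> dim s = len s.
Proof.
apply: contra_neq_eq => sd; apply: path_coeff_eq0.
by rewrite edge_path_len.
Qed.

Fact dual_subproof (a : path_algebra e) :
  (fun s : simplex d => path_coeff (val s) a) \in fin_bideg (d := d).
Proof.
apply/asboolP; exists [seq (size (val p).2, size (val p).2) | p <- dom a] => s sa.
have [p pa ps] := path_coeff_neq0 sa.
by apply/mapP; exists p; rewrite // ps -(dual_on_diagonal sa).
Qed.
Definition dual_cochain (a : path_algebra e) : cochain d :=
  Cochain (dual_subproof a).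

Definition dual (a : path_algebra e) : cocycle d :=
  Cocycle (on_diagonal_cocycle (gdistxx e) (@gdist_eq0 _ e)
    (f := dual_cochain a) (@dual_on_diagonal a)).

Fact dual_zmod_morphism : zmod_morphism dual.
Proof.
move=> a b; apply/val_inj/cochainP => s.
by rewrite cochainBE /= raddfB.
Qed.

Fact dual_monoid_morphism : monoid_morphism dual.
Proof.
split; first by apply/val_inj/cochainP => s; exact: path_coeff1.
by move=> a b; apply/val_inj/cochainP => s; exact: path_coeffM.
Qed.

HB.instance Definition _ :=
  GRing.isZmodMorphism.Build (path_algebra e) (cocycle d) dual dual_zmod_morphism.
HB.instance Definition _ :=
  GRing.isMonoidMorphism.Build (path_algebra e) (cocycle d) dual
    dual_monoid_morphism.

Definition path_part (n : nat) (f : cochain d) : path_algebra e :=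
  sum_below e n (ext0 f).

Lemma path_coeff_path_part n (f : cochain d) (s : simplex d) :
  path_coeff (val s) (path_part n f) = if (dim s == len s) && (dim s < n)%N
                                       then f s else 0.
Proof. by rewrite path_coeff_sum_below edge_path_len // ext0_val. Qed.

(** A cochain vanishes outside finitely many bidegrees because the cohomology
    ring is a direct sum, not a product, over them. This makes the element of
    the path algebra dual to a diagonal cochain a finite sum. *)
Lemma dim_bounded (f : cochain d) : exists n, forall s, f s != 0 -> (dim s < n)%N.
Proof.
have /asboolP[B hB] := cfunP f; exists (\max_(b <- B) b.1).+1 => s /hB sB.
by rewrite ltnS (@leq_bigmax_seq _ B xpredT fst (dim s, len s)).
Qed.

Lemma dual_path_part (f : cochain d) :
  exists n, cocycle_val (dual (path_part n f)) = diag_part f.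
Proof.
have [n fn] := dim_bounded f; exists n; apply/cochainP => s.
rewrite /= path_coeff_path_part; case: eqP => //= _.
by case: ifP => // sn; apply/esym/eqP; apply: contraFT sn; apply: fn.
Qed.

Lemma dual_surj (e_diag : diagonal e) (z : cocycle d) :
  exists a, z - dual a \in coboundary_ideal d.
Proof.
have [n zn] := dual_path_part z; exists (path_part n z).
have [g gz] := cocycle_diag_part (gdistxx e) (@gdist_eq0 _ e)
  (@gdist_triangular _ e) e_diag (cocycleP z).
by apply/asboolP; exists g; rewrite gz -zn.
Qed.

(** Consecutive vertices of a simplex are distinct, so the only way to write 2
    as the sum of their distances is 1 + 1. *)
Lemma between_dist2 x y z : is_simplex d (x, [:: y; z]) -> d x z = Some 2%N ->
  between d x y z = e x y && e y z.
Proof.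
rewrite /is_simplex /between -!(gdist_eq1 e_irr) /= => /andP[/and3P[xy yz _] fin] ->.
case exy: (d x y) => [[|m]|] /=; last by rewrite exy in fin.
  by move/gdist_eq0: exy xy => ->; rewrite eqxx.
case eyz: (d y z) => [[|n]|] /=; last by rewrite exy eyz in fin.
  by move/gdist_eq0: eyz yz => ->; rewrite eqxx.
apply/eqP/andP => [[mn]|[/eqP[->] /eqP[->]] //].
by split; apply/eqP; congr Some; lia.
Qed.

(** The simplices having (x, z) as a face of the same length are the (x, y, z)
    with y a midpoint; the sign of this inner face is -1. *)
Lemma dual_relation (r : path_algebra e) :
  path_relation r -> dual r \in coboundary_ideal d.
Proof.
move=> [x [z [xz ->]]]; apply/asboolP.
have ss : is_simplex d (x, [:: z]).
  by rewrite /is_simplex /= xz !andbT; case: eqP xz => // ->; rewrite gdistxx.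
pose t : simplex d := Sub (x, [:: z]) ss.
exists (- delta t); apply/cochainP => s.
have -> : cobdry (- delta t) = - cobdry (delta t).
  by rewrite -[- delta t]sub0r cobdryB -(subrr (delta t)) cobdryB subrr sub0r.
rewrite -[LHS]/(- cobdry_fun (delta t) s) cobdry_funE.
have deltaE w : ext0 (delta t) w = (w == (x, [:: z]))%:R.
  rewrite /ext0; case: insubP => [u _ <-|].
    by rewrite /= -val_eqE.
  by case: eqP => // ->; rewrite ss.
move: (ext0 (delta t)) deltaE => D DE; rewrite -[RHS]/(path_coeff (val s) _).
move: (val s) (valP s) => w /= sw; rewrite linear_sum /=.
have [|w2] := boolP (size w.2 == 2); last first.
  rewrite big1 => [|y _]; last first.
    rewrite path_coeff_pelt; case: eqP => [ew|]; last by rewrite andbF.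
    by rewrite -ew in w2.
  rewrite /wcobdry big_nat big1 ?oppr0 // => i hi.
  case: ifP => _; rewrite ?mulr0 // DE.
  have [u [a [y [v [b [ew ->]]]]]] := wordP hi.
  rewrite ew wfaceE; case: eqP => [[_ ab]|]; last by rewrite mulr0.
  case/negP: w2; move/(congr1 size): ab; rewrite /= !size_cat /= addnS => -[ab0].
  by rewrite ew /= size_cat /= !addnS ab0.
case: w sw => u [|y [|v [|? ?]]] //= sw _.
rewrite /wcobdry /= big_nat1 DE mulN1r opprK /wface /= xpair_eqE.
rewrite -[smooth_at d _ 1]/(between d u y v).
under eq_bigr => c _ do rewrite path_coeff_pelt !xpair_eqE /=.
have [ux|ux] := eqVneq x u; last first.
  rewrite big1 => [|c _]; last by rewrite andbF.
  by rewrite if_same.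
subst u; rewrite andTb eqseq_cons eqxx andbT.
have [vz|vz] := eqVneq v z; last first.
  rewrite big1 ?if_same // => c _.
  by rewrite !eqseq_cons [z == v]eq_sym (negbTE vz) /= !andbF.
subst v; rewrite between_dist2 //.
under eq_bigl => c do rewrite !gdist_eq1 //.
rewrite big_mkcond (bigD1 y) //= big1 ?addr0 => [|c cy].
  by rewrite eqxx andbT; case: (e x y); case: (e y z).
by rewrite !eqseq_cons (negbTE cy) /= !andbF if_same.
Qed.



Lemma pmulZl k (a b : path_algebra e) : k *: (a * b) = (k *: a) * b.
Proof. by have := pmulPl k a 0 b; rewrite pmul0l !addr0. Qed.

Lemma path_idealZ k (a : path_algebra e) :
  a \in path_ideal e -> k *: a \in path_ideal e.
Proof.
by case: (ideal2P (path_ideal e)) => _ _ hl _ ha; rewrite -[a]mul1r pmulZl hl.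
Qed.

(** Both sides are 0 when the word is not an edge path. *)
Lemma pelt_cat x a y z b : pelt e (x, a ++ [:: y, z & b]) =
  pelt e (x, a) * pelt e (last x a, [:: y; z]) * pelt e (z, b).
Proof.
rewrite -[RHS]/(pmul (pmul _ _) _) pmul_pelt /= eqxx !andbT.
have catE : path e x (a ++ [:: y, z & b]) =
    [&& path e x a, e (last x a) y, e y z & path e z b].
  by rewrite cat_path.
case: ifP => [/and3P[xa ay yz]|h].
  rewrite pmul_pelt /= cat_path /= last_cat /= xa ay yz eqxx -catA /=.
  rewrite andbT; case: ifP => // zb.
  by rewrite /pelt insubN // catE xa zb !andbF.
rewrite pmul0l /pelt insubN // catE.
by apply: contraFN h => /and4P[-> -> ->].
Qed.

(** If d u z = 2 the midpoints y are the common neighbours and this is a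
    relation; otherwise no y between u and z is adjacent to both, and all
    terms are 0. *)
Lemma sum_between_ideal u z :
  \sum_(y | between d u y z) pelt e (u, [:: y; z]) \in path_ideal e.
Proof.
have [uz|uz] := eqVneq (d u z) (Some 2%N).
  apply/asboolP => I _; apply; exists u, z; split=> //.
  rewrite big_mkcond [RHS]big_mkcond; apply: eq_bigr => y _.
  rewrite /between uz !(gdist_eq1 e_irr).
  have [uyz|uyz] := boolP (e u y && e y z).
    move: uyz; rewrite -!(gdist_eq1 e_irr) => /andP[/eqP-> /eqP->].
    by rewrite eqxx.
  by rewrite /pelt insubN ?if_same //= andbT.
rewrite big1 ?rpred0 // => y; rewrite /between => uyz.
rewrite /pelt insubN //=; apply: contraNN uz.
rewrite andbT -!(gdist_eq1 e_irr) => /andP[/eqP uy /eqP yz].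
by rewrite (eqP uyz) uy yz.
Qed.

(** The paths are grouped by what remains after the deletion of the vertex y
    in position i. In each group G is constant, the part before y and the part
    after y are constant factors, and the sum over y is a relation or 0. *)
Lemma face_sum_ideal k i (G : T * seq T -> int) : (0 < i < k)%N ->
  sum_of_length e k (fun w => if smooth_at d w i then G (wface w i) else 0)
    \in path_ideal e.
Proof.
move=> /andP[i0 ik]; apply: rpred_sum => x _.
(* Vertex 0 is x, outside the word: i - 1 letters a, then y, z, then b. *)
have -> : k = (i.-1 + (k - i.+1).+2)%N by lia.
rewrite big_words_cat big_seq; apply: rpred_sum => a.
rewrite mem_words => /eqP sa; rewrite big_wordsS.
under eq_bigr => y _ do rewrite big_wordsS.
rewrite exchange_big; apply: rpred_sum => z _.
rewrite exchange_big; apply: rpred_sum => b _ /=.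
have -> : i = (size a).+1 by rewrite sa prednK.
under eq_bigr => y _ do rewrite smooth_atE wfaceE pelt_cat.
have -> : \sum_y (if between d (last x a) y z then G (x, a ++ z :: b) else 0) *:
    (pelt e (x, a) * pelt e (last x a, [:: y; z]) * pelt e (z, b)) =
  G (x, a ++ z :: b) *: (pelt e (x, a) *
    (\sum_(y | between d (last x a) y z) pelt e (last x a, [:: y; z])) *
    pelt e (z, b)).
  rewrite mulr_sumr mulr_suml scaler_sumr [RHS]big_mkcond; apply: eq_bigr => y _.
  by case: ifP; rewrite ?scale0r.
apply: path_idealZ; case: (ideal2P (path_ideal e)) => _ _ hl hr.
by apply/hr/hl/sum_between_ideal.
Qed.

Lemma wcobdry_sum_ideal k (G : T * seq T -> int) :
  sum_of_length e k (wcobdry d G) \in path_ideal e.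
Proof.
suff -> : sum_of_length e k (wcobdry d G) = \sum_(1 <= i < k) (-1) ^+ i *:
    sum_of_length e k (fun w => if smooth_at d w i then G (wface w i) else 0).
  rewrite big_nat; apply: rpred_sum => i hi; apply: path_idealZ.
  exact: face_sum_ideal.
apply: path_algebra_eqP => w ew; rewrite path_coeff_sum_of_length ew /= linear_sum /=.
under eq_bigr => i _ do rewrite linearZ /= path_coeff_sum_of_length ew /=.
by case: eqP => [<-//|_]; rewrite big1 // => i _; rewrite scaler0.
Qed.

Lemma sum_below_coeff (a : path_algebra e) :
  exists n, a = sum_below e n (fun w => path_coeff w a).
Proof.
exists (\max_(p <- dom a) size (val p).2).+1; apply: path_algebra_eqP => w ew.
rewrite path_coeff_sum_below ew /= ltnS; case: ifP => // h; apply/eqP.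
apply: contraFT h => /path_coeff_neq0[p pa <-].
exact: (leq_bigmax_seq (F := fun p : epath e => size (val p).2)).
Qed.

(** If dual a is the coboundary of g, then a is the sum of the paths weighted
    by the coboundary of g, up to any length that exceeds those of the paths
    in a. *)
Lemma dual_kernel (a : path_algebra e) :
  (dual a \in coboundary_ideal d) = (a \in path_ideal e).
Proof.
apply/idP/idP => [/asboolP[g ga]|/asboolP].
  have [n an] := sum_below_coeff a.
  have -> : a = \sum_(k < n) sum_of_length e k (wcobdry d (ext0 g)).
    rewrite an; apply: path_algebra_eqP => w ew.
    rewrite -/(sum_below e n (wcobdry d (ext0 g))) !path_coeff_sum_below.
    case: ifP => // _.
    pose s : simplex d := Sub w (edge_path_simplex e_irr ew).
    have /cochainP/(_ s) := ga.
    by rewrite /= cobdry_funE SubK => ->.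
  by apply: rpred_sum => k _; apply: wcobdry_sum_ideal.
move/(_ [pred b | dual b \in coboundary_ideal d]).
apply; last by move=> r; rewrite inE; apply: dual_relation.
case: (ideal2P (coboundary_ideal d)) => h0 hB hl hr; split.
- by rewrite inE rmorph0.
- by move=> x y; rewrite !inE => hx hy; rewrite rmorphB hB.
- by move=> b x; rewrite !inE => hx; rewrite rmorphM hl.
- by move=> b x; rewrite !inE => hx; rewrite rmorphM hr.
Qed.

End DualBasis.

(** * The theorem *)

Theorem corollary6p3 (T : finType) (e : rel T) (e_sym : symmetric e)
    (e_irr : irreflexive e) (e_diag : diagonal e) :
  exists f : {rmorphism MHring (gdist e) -> path_quot e},
    bijective f /\
    forall (k : nat) (x : MHring (gdist e)),
      MH_part k k x <-> path_quot_part k (f x).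
Proof.
have [f [f_bij fE]] := quotient_iso (u := dual e_irr) (dual_kernel e_irr)
  (dual_surj e_irr e_diag).
exists f; split=> // k x; split.
  move=> [z zk ->]; have [n zn] := dual_path_part e_irr z.
  have <- : dual e_irr (path_part n z) = z.
    apply/val_inj; rewrite [LHS]zn; apply/cochainP => s /=.
    case: eqP => // sd; apply/esym/eqP; apply: contra_notT sd.
    by move=> /zk[-> ->].
  exists (path_part n z); last exact: fE.
  move=> p; rewrite mem_dom -path_coeffE path_coeff_sum_below (valP p) /=.
  case: ifP => _; rewrite ?eqxx // /ext0.
  by case: insubP => [s _ <- /zk[<- _]|]; rewrite ?eqxx.
move=> [a ak fx]; exists (dual e_irr a); last first.
  by apply: (bij_inj f_bij); rewrite fE.
move=> s sa; rewrite -(dual_on_diagonal e_irr sa).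
have [p pa ps] := path_coeff_neq0 sa.
by rewrite -(ak p pa) ps.
Qed.
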